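(* For every Lie groupoid $\mathbb{X}$, the thin fundamental groupoid $\Pi_{\mathrm{thin}}(\mathbb{X})=\left[\frac{P\mathbb{X}}{\sim}\rightrightarrows X_0\right]$ is a diffeological groupoid.
   Context: In a Lie groupoid $\mathbb{X}=[X_1\rightrightarrows X_0]$ the source and target are $s,t$, the unit is $x\mapsto 1_x$, and $\gamma_2\circ\gamma_1$ is defined when $t(\gamma_1)=s(\gamma_2)$. A path with sitting instants in a manifold $M$ is a smooth map $\alpha:[0,1]\to M$ for which there is $\epsilon\in(0,1/2)$ with $\alpha$ constant on $[0,\epsilon)$ and on $(1-\epsilon,1]$; $\mathrm{P}(M)$ is the set of these; $\alpha^{-1}(r)=\alpha(1-r)$; and $\beta*\alpha$ is the concatenation, first $\alpha$ and then $\beta$. Two such paths $\alpha,\beta$ from $x$ to $y$ are thin homotopic if there is a smooth $H:[0,1]^2\to M$ whose differential has rank at most $1$ everywhere and an $\epsilon\in(0,1/2)$ such that $H(r,r')=x$ for $r'\in[0,\epsilon)$, $H(r,r')=y$ for $r'\in(1-\epsilon,1]$, $H(r,r')=\alpha(r')$ for $r\in[0,\epsilon)$, and $H(r,r')=\beta(r')$ for $r\in(1-\epsilon,1]$. A lazy $\mathbb{X}$-path of order $n\geq 0$ from $x$ to $y$ is a sequence $\Gamma=(\gamma_0,\alpha_1,\gamma_1,\dots,\alpha_n,\gamma_n)$ with $\gamma_i\in X_1$ and $\alpha_i\in\mathrm{P}(X_0)$, such that $s(\gamma_0)=x$, $t(\gamma_n)=y$, $s(\gamma_i)=\alpha_i(1)$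 for $0<i\le n$, and $t(\gamma_i)=\alpha_{i+1}(0)$ for $0\le i<n$. $P\mathbb{X}_n$ is the set of those of order $n$, and $P\mathbb{X}=\bigsqcup_{n\ge0}P\mathbb{X}_n$. Two lazy $\mathbb{X}$-paths are equivalent if one is obtained from the other by finitely many of the following operations. (1) Removing or adding a constant path: if $\alpha_{i+1}$ is constant, $i\in\{0,\dots,n-1\}$, replace $\gamma_i,\alpha_{i+1},\gamma_{i+1}$ by $\gamma_{i+1}\circ\gamma_i$; or the reverse. (2) Removing or adding an identity: if $\gamma_i$ is an identity, $i\in\{1,\dots,n-1\}$, replace $\alpha_i,\gamma_i,\alpha_{i+1}$ by $\alpha_{i+1}*\alpha_i$; or the reverse. (3) For $\zeta_i\in\mathrm{P}(X_1)$ with $s\circ\zeta_i=\alpha_i$, $i\in\{1,\dots,n\}$, replace $\gamma_{i-1},\alpha_i,\gamma_i$ by $\zeta_i(0)\circ\gamma_{i-1},\ t\circ\zeta_i,\ \gamma_i\circ\zeta_i(1)^{-1}$. A thin deformation from $(\gamma_0,\alpha_1,\dots,\alpha_n,\gamma_n)$ to $(\gamma'_0,\alpha'_1,\dots,\alpha'_n,\gamma'_n)$ is a family $\zeta_i\in\mathrm{P}(X_1)$, $i=0,\dots,n$, with $\zeta_i(0)=\gamma_i$ and $\zeta_i(1)=\gamma'_i$, such that $\alpha_i$ is thin homotopic to $(s\circ\zeta_i)^{-1}*\alpha'_i*(t\circ\zeta_{i-1})$ for $i=1,\dots,n$, and $s\circ\zeta_0$ and $t\circ\zeta_n$ are constant.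 The relation $\sim$ on $P\mathbb{X}$ (lazy $\mathbb{X}$-path thin homotopy) is the equivalence relation generated by operations (1)-(3) and thin deformations. The thin fundamental groupoid $\Pi_{\mathrm{thin}}(\mathbb{X})$ has objects $X_0$ and morphisms $\frac{P\mathbb{X}}{\sim}$. Its source is $[\Gamma]\mapsto s(\gamma_0)$ and its target is $[\Gamma]\mapsto t(\gamma_n)$. Its composition is $[(\gamma'_0,\alpha'_1,\dots,\gamma'_n)]\circ[(\gamma_0,\alpha_1,\dots,\gamma_m)]=[(\gamma_0,\alpha_1,\dots,\alpha_m,\gamma'_0\circ\gamma_m,\alpha'_1,\dots,\gamma'_n)]$. Its unit is $x\mapsto[(1_x,c_x,1_x)]$ with $c_x$ the constant path at $x$. Its inverse is $[(\gamma_0,\alpha_1,\dots,\alpha_n,\gamma_n)]\mapsto[(\gamma_n^{-1},\alpha_n^{-1},\dots,\alpha_1^{-1},\gamma_0^{-1})]$. Diffeologies. A manifold carries the diffeology of smooth maps from open subsets of Euclidean spaces. A map $p:U\to\mathrm{P}(X_0)$ is a plot iff $(u,r)\mapsto p(u)(r)$ is smooth on $U\times[0,1]$. $P\mathbb{X}_n=X_1\times_{t,X_0,ev_0}\mathrm{P}(X_0)\times_{ev_1,X_0,s}X_1\times\cdots\times_{ev_1,X_0,s}X_1$ carries the fibre product diffeology (plots are the componentwise plots), where $ev_0,ev_1$ are evaluation at $0,1$. $P\mathbb{X}$ carries the sum diffeology (locally a plot of some $P\mathbb{X}_n$). $\frac{P\mathbb{X}}{\sim}$ carries the quotient diffeology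 (plots locally lift to plots of $P\mathbb{X}$). A diffeological groupoid is a groupoid object in the category of diffeological spaces: source, target, unit, inverse and composition (on the fibre product with its fibre product diffeology) are maps of diffeological spaces, i.e. send plots to plots under composition. *)

(* Defs.v *)
From HB Require Import structures.
From Stdlib Require Import Relation_Operators.
From mathcomp Require Import all_boot all_order all_algebra generic_quotient.
From mathcomp Require Import all_classical all_reals all_analysis.

Set Implicit Arguments.
Unset Strict Implicit.
Unset Printing Implicit Defensive.

Import Order.TTheory GRing.Theory Num.Theory.
Import numFieldNormedType.Exports.

Local Open Scope classical_set_scope.
Local Open Scope ring_scope.
Local Open Scope quotient_scope.

(* [V] and [W] are always finite dimensional below ([R], ['rV[R]_n] and binary
   products of these), where this is the usual notion of a C^k map on the open
   set [U]. *)
Fixpoint Ck (R : realType) (V W : normedModType R) (k : nat) (U : set V)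
    (f : V -> W) : Prop :=
  match k with
  | 0 => forall x, U x -> {for x, continuous f}
  | k'.+1 => (forall x, U x -> differentiable f x) /\
             (forall v : V, Ck k' U (fun x => 'D_v f x : W))
  end.

Definition Cinfty (R : realType) (V W : normedModType R) (U : set V)
    (f : V -> W) : Prop := forall k, Ck k U f.

(* [chart_inv] is only meaningful on the image of [chart_dom]. *)
Record chart (R : realType) (M : topologicalType) (n : nat) := Chart {
  chart_dom : set M;
  chart_map : M -> 'rV[R]_n;
  chart_inv : 'rV[R]_n -> M;
  chart_dom_open : open chart_dom;
  chart_img_open : open (chart_map @` chart_dom);
  chart_mapK : forall x, chart_dom x -> chart_inv (chart_map x) = x;
  chart_map_continuous : forall x, chart_dom x -> {for x, continuous chart_map};
  chart_inv_continuous : forall v, (chart_map @` chart_dom) v ->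
    {for v, continuous chart_inv}
}.

Definition chart_img (R : realType) (M : topologicalType) (n : nat)
  (c : chart R M n) : set 'rV[R]_n := chart_map c @` chart_dom c.

(* The atlas is not required to be maximal; the smooth structure is that of the
   maximal atlas containing it. *)
Record manifold (R : realType) := Manifold {
  mcarrier :> topologicalType;
  mdim : nat;
  atlas : set (chart R mcarrier mdim);
  mhausdorff : hausdorff_space mcarrier;
  msecond_countable : @second_countable mcarrier;
  atlas_cover : forall x : mcarrier, exists2 c, atlas c & chart_dom c x;
  atlas_compatible : forall c d, atlas c -> atlas d ->
    Cinfty (chart_map c @` (chart_dom c `&` chart_dom d))
           (fun v => chart_map d (chart_inv c v))
}.

(* Near [a], in the chart [c] around [f a], the restriction of [f] to [A] is
   the restriction to [A] of the smooth map [g], defined on the open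
   neighbourhood [W] of [a]. *)
Definition local_rep (R : realType) (V : normedModType R) (M : manifold R)
    (A : set V) (f : V -> M) (a : V)
    (c : chart R M (mdim M)) (W : set V) (g : V -> 'rV[R]_(mdim M)) : Prop :=
  [/\ atlas c, open W, W a, Cinfty W g &
      forall x, W x -> A x -> chart_dom c (f x) /\ chart_map c (f x) = g x].

(* Smoothness of a map from an arbitrary subset [A] of a Euclidean space (an
   open set, [0,1], [0,1]^2, U x [0,1], a submanifold) to a manifold, in the
   sense of local smooth extensions; only the values of [f] on [A] matter. *)
Definition smooth_on (R : realType) (V : normedModType R) (M : manifold R)
    (A : set V) (f : V -> M) : Prop :=
  forall a, A a -> exists c W g, local_rep A f a c W g.

Definition smooth_map (R : realType) (M N : manifold R) (f : M -> N) : Prop :=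
  forall c, atlas c -> smooth_on (chart_img c) (fun v => f (chart_inv c v)).

Definition submersion (R : realType) (M N : manifold R) (f : M -> N) : Prop :=
  smooth_map f /\
  forall (p : M) (c : chart R M (mdim M)) (d : chart R N (mdim N)),
    atlas c -> atlas d -> chart_dom c p -> chart_dom d (f p) ->
    forall w : 'rV[R]_(mdim N), exists v : 'rV[R]_(mdim M),
      'd (fun u => chart_map d (f (chart_inv c u)) : 'rV[R]_(mdim N))
         (chart_map c p) v = w.

(* [comp g f] is "g after f". It is total, but its value is only meaningful
   when [src g = tgt f]. *)
Record is_groupoid (O A : Type) (src tgt : A -> O) (unit : O -> A)
    (inv : A -> A) (comp : A -> A -> A) : Prop := IsGroupoid {
  gpd_src_unit : forall x, src (unit x) = x;
  gpd_tgt_unit : forall x, tgt (unit x) = x;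
  gpd_src_inv : forall g, src (inv g) = tgt g;
  gpd_tgt_inv : forall g, tgt (inv g) = src g;
  gpd_src_comp : forall g f, src g = tgt f -> src (comp g f) = src f;
  gpd_tgt_comp : forall g f, src g = tgt f -> tgt (comp g f) = tgt g;
  gpd_compA : forall h g f, src h = tgt g -> src g = tgt f ->
    comp h (comp g f) = comp (comp h g) f;
  gpd_comp_unitr : forall g, comp g (unit (src g)) = g;
  gpd_comp_unitl : forall g, comp (unit (tgt g)) g = g;
  gpd_comp_invl : forall g, comp (inv g) g = unit (src g);
  gpd_comp_invr : forall g, comp g (inv g) = unit (tgt g)
}.

(* [lg_comp_smooth] is smoothness of the composition on the submanifold
   {(g, f) | s g = t f} of X_1 x X_1, expressed in charts of X_1 x X_1. *)
Record lie_groupoid (R : realType) := LieGroupoid {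
  lg_ob : manifold R;
  lg_arr : manifold R;
  lg_src : lg_arr -> lg_ob;
  lg_tgt : lg_arr -> lg_ob;
  lg_unit : lg_ob -> lg_arr;
  lg_inv : lg_arr -> lg_arr;
  lg_comp : lg_arr -> lg_arr -> lg_arr;
  lg_groupoid : is_groupoid lg_src lg_tgt lg_unit lg_inv lg_comp;
  lg_src_submersion : submersion lg_src;
  lg_tgt_submersion : submersion lg_tgt;
  lg_unit_smooth : smooth_map lg_unit;
  lg_inv_smooth : smooth_map lg_inv;
  lg_comp_smooth : forall c d, atlas c -> atlas d ->
    smooth_on
      [set z : 'rV[R]_(mdim lg_arr) * 'rV[R]_(mdim lg_arr) |
        [/\ chart_img c z.1, chart_img d z.2 &
            lg_src (chart_inv c z.1) = lg_tgt (chart_inv d z.2)]]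
      (fun z => lg_comp (chart_inv c z.1) (chart_inv d z.2))
}.

Arguments lg_src {R l} _.
Arguments lg_tgt {R l} _.
Arguments lg_unit {R l} _.
Arguments lg_inv {R l} _.
Arguments lg_comp {R l} _ _.

Definition I01 (R : realType) : set R := [set r | 0 <= r <= 1].
Arguments I01 R : clear implicits.

(* A path [0,1] -> M with sitting instants is encoded by its extension to R
   that is constant on ]-oo, 0] and on [1, +oo[; equality of paths is thus
   equality of functions. *)
Definition sitting_path (R : realType) (M : manifold R) (a : R -> M) : Prop :=
  smooth_on (I01 R) a /\
  exists e : R, [/\ 0 < e, e < 1 / 2,
    forall r, r < e -> a r = a 0 & forall r, 1 - e < r -> a r = a 1].

Definition is_constant (T U : Type) (a : T -> U) : Prop :=
  forall r r', a r = a r'.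

Definition path_const (R : realType) (M : Type) (x : M) : R -> M := fun=> x.
Arguments path_const R {M} x _ : rename.

Definition path_rev (R : realType) (M : Type) (a : R -> M) : R -> M :=
  fun r => a (1 - r).

(* First [a], then [b]. *)
Definition path_cat (R : realType) (M : Type) (b a : R -> M) : R -> M :=
  fun r => if r <= 1 / 2 then a (2 * r) else b (2 * r - 1).

(* The derivative of a local smooth extension at a point of the square does
   not depend on the extension, the square being the closure of its interior;
   the matrix below is the (transposed) Jacobian of H at z in a chart. *)
Definition thin_homotopic (R : realType) (M : manifold R) (a b : R -> M)
    : Prop :=
  [/\ sitting_path a, sitting_path b, a 0 = b 0, a 1 = b 1 &
  exists (H : R * R -> M),
    [/\ smooth_on (I01 R `*` I01 R) H,
        forall z, (I01 R `*` I01 R) z -> exists c W g,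
          local_rep (I01 R `*` I01 R) H z c W g /\
          (\rank (col_mx ('D_(1%R, 0%R) g z : 'rV[R]_(mdim M))
                         ('D_(0%R, 1%R) g z : 'rV[R]_(mdim M))) <= 1)%N &
        exists e : R, [/\ 0 < e, e < 1 / 2,
          forall r r', I01 R r -> I01 R r' -> r' < e -> H (r, r') = a 0,
          forall r r', I01 R r -> I01 R r' -> 1 - e < r' -> H (r, r') = a 1 &
          (forall r r', I01 R r -> I01 R r' -> r < e -> H (r, r') = a r') /\
          (forall r r', I01 R r -> I01 R r' -> 1 - e < r -> H (r, r') = b r')]]].

(* [(g0, [:: (a1, g1); ...; (an, gn)])] encodes (g0, a1, g1, ..., an, gn). *)
Definition raw_lazy (R : realType) (X : lie_groupoid R) : Type :=
  (lg_arr X * seq ((R -> lg_ob X) * lg_arr X))%type.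

Fixpoint lazy_chain (R : realType) (X : lie_groupoid R) (g : lg_arr X)
    (l : seq ((R -> lg_ob X) * lg_arr X)) : Prop :=
  match l with
  | [::] => True
  | (a, g') :: l' =>
      [/\ sitting_path a, lg_tgt g = a 0, lg_src g' = a 1 & lazy_chain g' l']
  end.

Record lazy_path (R : realType) (X : lie_groupoid R) := LazyPath {
  lp_raw :> raw_lazy X;
  lp_chain : lazy_chain lp_raw.1 lp_raw.2
}.

HB.instance Definition _ (R : realType) (X : lie_groupoid R) :=
  gen_eqMixin (lazy_path X).
HB.instance Definition _ (R : realType) (X : lie_groupoid R) :=
  gen_choiceMixin (lazy_path X).

Definition lp_order (R : realType) (X : lie_groupoid R) (G : raw_lazy X) : nat :=
  size G.2.

(* g_i, for 0 <= i <= n. *)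
Definition lp_arr (R : realType) (X : lie_groupoid R) (i : nat)
  (G : raw_lazy X) : lg_arr X := nth G.1 (G.1 :: unzip2 G.2) i.

(* a_(i+1), for 0 <= i < n. *)
Definition lp_path (R : realType) (X : lie_groupoid R) (i : nat)
  (G : raw_lazy X) : R -> lg_ob X :=
  nth (path_const R (lg_tgt G.1)) (unzip1 G.2) i.

Definition lp_src (R : realType) (X : lie_groupoid R) (G : raw_lazy X)
  : lg_ob X := lg_src G.1.

Definition lp_tgt (R : realType) (X : lie_groupoid R) (G : raw_lazy X)
  : lg_ob X := lg_tgt (last G.1 (unzip2 G.2)).

(* The moves are oriented here; [lazy_thin] takes the symmetric closure and
   applies them between genuine lazy paths only, so all the composites and
   concatenations are meaningful. [move_cons] propagates a move at the front of
   a sequence to an arbitrary place in it. *)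
Inductive lazy_move (R : realType) (X : lie_groupoid R)
    : raw_lazy X -> raw_lazy X -> Prop :=
| move_constant (g g' : lg_arr X) (a : R -> lg_ob X) l :
    is_constant a ->
    lazy_move (g, (a, g') :: l) (lg_comp g' g, l)
| move_identity (g g' : lg_arr X) (x : lg_ob X) (a b : R -> lg_ob X) l :
    lazy_move (g, (a, lg_unit x) :: (b, g') :: l) (g, (path_cat b a, g') :: l)
| move_conjugate (g g' : lg_arr X) (z : R -> lg_arr X) l :
    sitting_path z ->
    lazy_move (g, (lg_src \o z, g') :: l)
      (lg_comp (z 0) g, (lg_tgt \o z, lg_comp g' (lg_inv (z 1))) :: l)
| move_cons (g g1 g2 : lg_arr X) (a : R -> lg_ob X) l1 l2 :
    lazy_move (g1, l1) (g2, l2) ->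
    lazy_move (g, (a, g1) :: l1) (g, (a, g2) :: l2).

Definition thin_deformation (R : realType) (X : lie_groupoid R)
    (G G' : raw_lazy X) : Prop :=
  lp_order G = lp_order G' /\
  exists z : nat -> R -> lg_arr X,
    [/\ forall i, (i <= lp_order G)%N ->
          [/\ sitting_path (z i), z i 0 = lp_arr i G & z i 1 = lp_arr i G'],
        forall i, (i < lp_order G)%N ->
          thin_homotopic (lp_path i G)
            (path_cat (path_cat (path_rev (lg_src \o z i.+1)) (lp_path i G'))
                      (lg_tgt \o z i)),
        is_constant (lg_src \o z 0%N) &
        is_constant (lg_tgt \o z (lp_order G))].

Definition lazy_thin (R : realType) (X : lie_groupoid R)
    : lazy_path X -> lazy_path X -> Prop :=
  clos_refl_sym_trans (lazy_path X)
    (fun G G' => lazy_move G G' \/ thin_deformation G G').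

Definition lazy_thinb (R : realType) (X : lie_groupoid R)
  : rel (lazy_path X) := fun G G' => `[< lazy_thin G G' >].

Lemma lazy_thinb_equiv (R : realType) (X : lie_groupoid R) :
  equiv_class_of (@lazy_thinb R X).
Proof.
split.
- by move=> G; apply/asboolP; apply: rst_refl.
- by move=> G G'; apply/asboolP/asboolP; apply: rst_sym.
- move=> G1 G2 G3 /asboolP h12 /asboolP h23; apply/asboolP.
  exact: rst_trans h12 h23.
Qed.

Canonical lazy_thin_equiv (R : realType) (X : lie_groupoid R) :=
  EquivRelPack (@lazy_thinb_equiv R X).

Definition thin_arr (R : realType) (X : lie_groupoid R) :=
  {eq_quot (@lazy_thin_equiv R X)}.

Definition thin_class (R : realType) (X : lie_groupoid R) (G : lazy_path X)
  : thin_arr X := \pi_(thin_arr X) G.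

Fixpoint raw_comp_rec (R : realType) (X : lie_groupoid R) (G' : raw_lazy X)
    (g : lg_arr X) (l : seq ((R -> lg_ob X) * lg_arr X)) : raw_lazy X :=
  match l with
  | [::] => (lg_comp G'.1 g, G'.2)
  | (a, g1) :: l1 => let r := raw_comp_rec G' g1 l1 in (g, (a, r.1) :: r.2)
  end.

Definition raw_comp (R : realType) (X : lie_groupoid R) (G' G : raw_lazy X)
  : raw_lazy X := raw_comp_rec G' G.1 G.2.

Definition raw_unit (R : realType) (X : lie_groupoid R) (x : lg_ob X)
  : raw_lazy X := (lg_unit x, [:: (path_const R x, lg_unit x)]).

Fixpoint raw_inv_rec (R : realType) (X : lie_groupoid R) (g : lg_arr X)
    (l acc : seq ((R -> lg_ob X) * lg_arr X)) : raw_lazy X :=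
  match l with
  | [::] => (lg_inv g, acc)
  | (a, g1) :: l1 => raw_inv_rec g1 l1 ((path_rev a, lg_inv g) :: acc)
  end.

Definition raw_inv (R : realType) (X : lie_groupoid R) (G : raw_lazy X)
  : raw_lazy X := raw_inv_rec G.1 G.2 [::].

Lemma raw_comp_rec_src (R : realType) (X : lie_groupoid R) (G' : raw_lazy X) g l :
  lg_tgt (last g (unzip2 l)) = lp_src G' ->
  lg_src (raw_comp_rec G' g l).1 = lg_src g.
Proof.
case: l => [|[a g1] l] //= h.
by rewrite (gpd_src_comp (lg_groupoid X)).
Qed.

Lemma raw_comp_chain (R : realType) (X : lie_groupoid R) (G' G : lazy_path X) :
  lp_tgt G = lp_src G' ->
  lazy_chain (raw_comp G' G).1 (raw_comp G' G).2.
Proof.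
case: G' G => -[g' l'] /= hG' [[g l] /= hG].
rewrite /raw_comp /lp_tgt /lp_src /=.
elim: l g hG => [|[a g1] l IHl] g /=.
  move=> _ h; case: l' hG' => [|[b g2] l2] //= [? h0 ? ?]; split=> //.
  by rewrite (gpd_tgt_comp (lg_groupoid X)).
move=> [ha h0 h1 hl] h; split=> //; last exact: IHl.
by rewrite raw_comp_rec_src.
Qed.

Definition lp_comp (R : realType) (X : lie_groupoid R) (G' G : lazy_path X)
  (h : lp_tgt G = lp_src G') : lazy_path X := LazyPath (raw_comp_chain h).

Lemma Ck_cst (R : realType) (V W : normedModType R) k (U : set V) (w : W) :
  Ck k U (fun=> w).
Proof.
elim: k w => [|k IHk] w /=; first by move=> x _; exact: cst_continuous.
split=> [x _|v]; first exact: differentiable_cst.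
have -> : (fun x : V => 'D_v (fun=> w) x : W) = (fun=> 0).
  by apply/funext => x; exact: derive_cst.
exact: IHk.
Qed.

Lemma Ck_rev (R : realType) (W : normedModType R) k (U : set R) (f : R -> W) :
  Ck k U f -> Ck k [set r | U (1 - r)] (fun r => f (1 - r)).
Proof.
have rev_cont (x : R) : {for x, continuous (fun r : R => 1 - r)}.
  by apply: continuousB; [exact: cst_continuous|exact: cvg_id].
elim: k f => [|k IHk] f /=.
  move=> hf x Ux; exact: (continuous_comp (rev_cont x) (hf _ Ux)).
move=> [df hf]; split=> [x Ux|v].
  apply: (@differentiable_comp _ _ _ _ (fun r : R => 1 - r) f); last exact: df.
  by apply: differentiableB.
have -> : (fun x : R => 'D_v (fun r : R => f (1 - r)) x : W) =
          (fun x => 'D_(- v) f (1 - x)).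
  apply/funext => x; rewrite /derive.
  set F := (X in lim (X @ _) = _); set G := (X in _ = lim (X @ _)).
  suff -> : F = G by [].
  apply/funext => h; rewrite /F /G /=; congr (_ *: (f _ - _)).
  by rewrite scalerN opprD addrCA.
exact: (IHk _ (hf (- v))).
Qed.

Lemma sitting_path_const (R : realType) (M : manifold R) (x : M) :
  sitting_path (path_const R x).
Proof.
split; last first.
  by exists 4^-1; split=> //; rewrite ?mul1r ?ltf_pV2 ?posrE ?ltr_nat.
move=> r _; have [c hc cx] := atlas_cover x.
exists c, setT, (fun=> chart_map c x); split=> //; first exact: openT.
by move=> k; exact: Ck_cst.
Qed.

Lemma sitting_path_rev (R : realType) (M : manifold R) (a : R -> M) :
  sitting_path a -> sitting_path (path_rev a).
Proof.
move=> [sa [e [e0 e1 a0 a1]]]; split; last first.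
  exists e; split=> //; rewrite /path_rev => r hr.
    by rewrite subr0 a1// ltrD2l ltrN2.
  by rewrite subrr a0// ltrBlDr -ltrBlDl.
move=> r /andP[r0 r1].
have Ir : I01 R (1 - r) by rewrite /I01 /= subr_ge0 r1 gerBl r0.
have [c [W [g [hc oW Wr gW hg]]]] := sa _ Ir.
exists c, [set t | W (1 - t)], (fun t => g (1 - t)); split=> //.
- apply: (@open_comp _ _ (fun t : R => 1 - t)) => // x _.
  by apply: continuousB; [exact: cst_continuous|exact: cvg_id].
- by move=> k; apply: Ck_rev.
- move=> x Wx /andP[x0 x1]; apply: hg => //.
  by rewrite /I01 /= subr_ge0 x1 gerBl x0.
Qed.

Lemma raw_unit_chain (R : realType) (X : lie_groupoid R) (x : lg_ob X) :
  lazy_chain (raw_unit x).1 (raw_unit x).2.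
Proof.
split=> //; first exact: sitting_path_const.
- exact: (gpd_tgt_unit (lg_groupoid X)).
- exact: (gpd_src_unit (lg_groupoid X)).
Qed.

Definition lp_unit (R : realType) (X : lie_groupoid R) (x : lg_ob X)
  : lazy_path X := LazyPath (raw_unit_chain x).

Lemma raw_inv_chain (R : realType) (X : lie_groupoid R) (G : lazy_path X) :
  lazy_chain (raw_inv G).1 (raw_inv G).2.
Proof.
case: G => -[g l] /= hG; rewrite /raw_inv /=.
have : lazy_chain (lg_inv g) [::] by [].
elim: l g hG [::] => [|[a g1] l IHl] g //= [ha h0 h1 hl] acc hacc.
apply: IHl => //=; split=> //; first exact: sitting_path_rev.
- by rewrite (gpd_tgt_inv (lg_groupoid X)) /path_rev subr0.
- by rewrite (gpd_src_inv (lg_groupoid X)) /path_rev subrr.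
Qed.

Definition lp_inv (R : realType) (X : lie_groupoid R) (G : lazy_path X)
  : lazy_path X := LazyPath (raw_inv_chain G).

(* [D n U p] reads: the restriction of [p] to [U] is a plot. *)
Definition plots (R : realType) (T : Type) : Type :=
  forall n : nat, set 'rV[R]_n -> ('rV[R]_n -> T) -> Prop.

Record is_diffeology (R : realType) (T : Type) (D : plots R T) : Prop :=
  IsDiffeology {
  plot_open : forall n (U : set 'rV[R]_n) p, D n U p -> open U;
  plot_ext : forall n (U : set 'rV[R]_n) p q,
    (forall u, U u -> p u = q u) -> D n U p -> D n U q;
  plot_constant : forall n (U : set 'rV[R]_n) x, open U -> D n U (fun=> x);
  plot_local : forall n (U : set 'rV[R]_n) p,
    (forall u, U u -> exists V : set 'rV[R]_n,
      [/\ V u, V `<=` U & D n V p]) -> D n U p;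
  plot_smooth : forall n m (U : set 'rV[R]_n) (V : set 'rV[R]_m) p
      (F : 'rV[R]_m -> 'rV[R]_n),
    D n U p -> open V -> Cinfty V F -> (forall v, V v -> U (F v)) ->
    D m V (p \o F)
}.

Definition diffeological_map (R : realType) (S T : Type) (DS : plots R S)
    (DT : plots R T) (f : S -> T) : Prop :=
  forall n (U : set 'rV[R]_n) p, DS n U p -> DT n U (f \o p).

Definition fibre_product (S T B : Type) (f : S -> B) (g : T -> B) : Type :=
  {z : S * T | f z.1 = g z.2}.

Definition fibre_plots (R : realType) (S T B : Type) (f : S -> B) (g : T -> B)
    (DS : plots R S) (DT : plots R T) : plots R (fibre_product f g) :=
  fun n U p => DS n U (fun u => (sval (p u)).1) /\
               DT n U (fun u => (sval (p u)).2).

Arguments fibre_plots {R S T B} f g DS DT n U p.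

Definition quotient_plots (R : realType) (T Q : Type) (pi : T -> Q)
    (D : plots R T) : plots R Q :=
  fun n U p => open U /\ forall u, U u -> exists V q,
    [/\ V u, V `<=` U, D n V q & forall v, V v -> pi (q v) = p v].

Record is_diffeological_groupoid (R : realType) (O A : Type)
    (DO : plots R O) (DA : plots R A) (src tgt : A -> O) (unit : O -> A)
    (inv : A -> A) (comp : A -> A -> A) : Prop := IsDiffeologicalGroupoid {
  dg_groupoid : is_groupoid src tgt unit inv comp;
  dg_ob_diffeology : is_diffeology DO;
  dg_arr_diffeology : is_diffeology DA;
  dg_src : diffeological_map DA DO src;
  dg_tgt : diffeological_map DA DO tgt;
  dg_unit : diffeological_map DO DA unit;
  dg_inv : diffeological_map DA DA inv;
  dg_comp : diffeological_map (fibre_plots src tgt DA DA) DA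
    (fun z : fibre_product src tgt => comp (sval z).1 (sval z).2)
}.

Definition manifold_plots (R : realType) (M : manifold R) : plots R M :=
  fun n U p => open U /\ smooth_on U p.

(* Plots of P(M); that each [p u] with [u] in [U] is a path with sitting
   instants is part of [lazy_path] where this is used. *)
Definition path_plots (R : realType) (M : manifold R) : plots R (R -> M) :=
  fun n U p => open U /\
    smooth_on (U `*` I01 R) (fun z : 'rV[R]_n * R => p z.1 z.2).

(* Plots with values in the lazy paths of order [k]. *)
Definition lazy_order_plots (R : realType) (X : lie_groupoid R) (k : nat)
    : plots R (lazy_path X) :=
  fun n U p =>
    [/\ open U,
        forall u, U u -> lp_order (p u) = k,
        forall i, (i <= k)%N ->
          manifold_plots U (fun u => lp_arr i (p u)) &
        forall i, (i < k)%N ->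
          path_plots U (fun u => lp_path i (p u))].

Definition lazy_plots (R : realType) (X : lie_groupoid R)
    : plots R (lazy_path X) :=
  fun n U p => open U /\ forall u, U u -> exists V k,
    [/\ V u, V `<=` U & @lazy_order_plots R X k n V p].

(* Main.v *)
From HB Require Import structures.
From Stdlib Require Import Relation_Operators.
Require Import Defs.
From mathcomp Require Import all_boot all_order all_algebra generic_quotient.
From mathcomp Require Import all_classical all_reals all_analysis.
From mathcomp Require Import ring lra.

Set Implicit Arguments.
Unset Strict Implicit.
Unset Printing Implicit Defensive.

Import Order.TTheory GRing.Theory Num.Theory.
Import numFieldNormedType.Exports.

Local Open Scope classical_set_scope.
Local Open Scope ring_scope.

(** The unit and inverse laws, which fail for lazy paths, hold for their classes
    because what stands in the way can be removed by the moves and by thin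
    deformations, and the structure maps are smooth because each of them lifts
    to lazy paths by an operation that is smooth entry by entry.

    All the thin homotopies that occur compare a path with the same path at the
    parameter p r + q: concatenating a path with sitting instants with
    constant paths only has this effect, since the path may be followed beyond
    its ends. Such a reparametrisation is a thin homotopy
    ([thin_homotopic_affine]) because the interpolation between two parameters,
    cut off by a smooth step, factors through the line. This rests on the
    calculus of iterated directional derivatives (the chain rule [Ck_comp]) and
    on a smooth step made out of exp(-1/x).

    For composition, two lazy paths are joined by a constant path instead of
    composing the two arrows where they meet; the removal of that constant path
    is one of the moves ([lazy_move_join_comp]), so the class is the same. The
    joined sequence contains both sequences unchanged, so that the equivalence
    relation is compatible with joining ([lazy_thin_joinr], [lazy_thin_joinl]),
    associativity is that of lists, and the join of two plots is a plot
    ([lazy_order_plots_join]). The unit laws are removals of constant paths.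

    For inverses, the key case is a path a followed by its reverse
    ([lazy_thin_backtrack]): the identity arrow between them is carried back
    along a by a thin deformation, under which both paths become constant and
    can be removed. Induction on the order gives the inverse law, and the
    inverse then passes to classes because inverses in a category are unique.

    A plot of the quotient lifts locally to a plot of lazy paths of a fixed
    order ([thin_plots_lift]). The source, target, unit and inverse of such a
    lift are obtained by composing its entries with smooth maps of the Lie
    groupoid and by reversing paths, and the composite is its join. *)

(** * Calculus of C^k maps *)

Lemma scale_is_bilinear (R : realType) (W : normedModType R) :
  bilinear_for
    (GRing.Scale.Law.clone _ _ *:%R _) (GRing.Scale.Law.clone _ _ *:%R _)
    (fun (r : R) (w : W) => r *: w).
Proof.
split=> [w|r] a x y /=; first by rewrite scalerDl scalerA.
by rewrite scalerDr !scalerA mulrC.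
Qed.

Lemma differentiable_scale (R : realType) (V W : normedModType R) (f : V -> R)
    (g : V -> W) (x v : V) :
  differentiable f x -> differentiable g x ->
  differentiable (fun y => f y *: g y) x /\
  'D_v (fun y => f y *: g y) x = f x *: 'D_v g x + 'D_v f x *: g x.
Proof.
move=> df dg.
pose bM := bilinear_isBilinear.Build R R W W _ _ _ (@scale_is_bilinear R W).
pose b : {bilinear R -> W -> W} := HB.pack (fun (r : R) (w : W) => r *: w) bM.
have cb : continuous (fun p : R * W => b p.1 p.2) by exact: scale_continuous.
have dp := differentiable_pair df dg.
have db := differentiable_bilin (f x, g x) cb.
have -> : (fun y => f y *: g y) =
    (fun p : R * W => b p.1 p.2) \o (fun y => (f y, g y)) by [].
have dfg := differentiable_comp dp db.
split=> //; rewrite !deriveE// diff_comp//= diff_pair//=.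
by rewrite (diff_bilin _ cb).
Qed.

(** The difference of the two maps vanishes near the point, hence is
    differentiable there with differential zero. *)
Lemma near_eq_differentiable (R : realType) (V W : normedModType R)
    (f g : V -> W) (x : V) :
  (\forall y \near x, f y = g y) -> differentiable f x -> differentiable g x.
Proof.
move=> fg df.
pose h : V -> W := g - f.
have hE : h \o shift x = cst (h x) + (\0 : V -> W) +o_ 0 id.
  apply/eqaddoP => _/posnumP[e].
  have : \forall y \near (0 : V), f (y + x) = g (y + x).
    by move: fg; rewrite (near_shift 0) /= subr0.
  apply: filterS => y fgy.
  have -> : (h \o shift x - (cst (h x) + (\0 : V -> W))) y =
      (g (y + x) - f (y + x)) - ((g x - f x) + 0) by [].
  have fgx : f x = g x by exact: nbhs_singleton fg.
  by rewrite fgy fgx !subrr addr0 subr0 normr0 mulr_ge0.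
have c0 : continuous (\0 : V -> W) by move=> y; exact: cst_continuous.
have dh : differentiable h x.
  by apply/diff_locallyP; rewrite (diff_unique c0 hE).
have -> : g = f + h by rewrite /h addrC subrK.
exact: differentiableD.
Qed.

(** Openness makes the derivatives on the set depend only on the values there,
    so that a derivative may be replaced by the formula that computes it. *)
Lemma Ck_ext (R : realType) (V W : normedModType R) k (U : set V)
    (f g : V -> W) :
  open U -> (forall x, U x -> f x = g x) -> Ck k U f -> Ck k U g.
Proof.
move=> oU; elim: k f g => [|k IHk] f g fg /=.
  move=> cf x Ux; rewrite /prop_for /continuous_at -fg//.
  apply: cvg_trans (cf x Ux); apply: near_eq_cvg.
  by apply: filterS (open_nbhs_nbhs (conj oU Ux)) => y /fg.
move=> [df Df].
have nfg x : U x -> \forall y \near x, f y = g y.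
  move=> Ux; apply: filterS (open_nbhs_nbhs (conj oU Ux)) => y; exact: fg.
split=> [x Ux|v].
  exact: near_eq_differentiable (nfg _ Ux) (df x Ux).
apply: IHk (Df v) => x Ux; exact/near_eq_derive/nfg.
Qed.

Lemma Ck_subset (R : realType) (V W : normedModType R) k (U U' : set V)
    (f : V -> W) :
  U' `<=` U -> Ck k U f -> Ck k U' f.
Proof.
move=> UU'; elim: k f => [|k IHk] f /=; first by move=> cf x /UU'; exact: cf.
by move=> [df Df]; split=> [x /UU'|v]; [exact: df|exact: IHk].
Qed.

Lemma CkW (R : realType) (V W : normedModType R) k (U : set V) (f : V -> W) :
  Ck k.+1 U f -> Ck k U f.
Proof.
elim: k f => [|k IHk] f; first by move=> [df _] x /df /differentiable_continuous.
by move=> [df Df]; split=> // v; exact: IHk.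
Qed.

Lemma CkD (R : realType) (V W : normedModType R) k (U : set V) (f g : V -> W) :
  open U -> Ck k U f -> Ck k U g -> Ck k U (fun x => f x + g x).
Proof.
move=> oU; elim: k f g => [|k IHk] f g /=.
  by move=> cf cg x Ux; apply: continuousD; [exact: cf|exact: cg].
move=> [df Df] [dg Dg]; split=> [x Ux|v].
  by apply: differentiableD; [exact: df|exact: dg].
apply: (Ck_ext oU) (IHk _ _ (Df v) (Dg v)) => x Ux.
by rewrite (@deriveD _ _ _ f g)//; apply: diff_derivable; [exact: df|exact: dg].
Qed.

Lemma Ck_sum (R : realType) (V W : normedModType R) k (U : set V) n
    (f : 'I_n -> V -> W) :
  open U -> (forall i, Ck k U (f i)) -> Ck k U (fun x => \sum_i f i x).
Proof.
move=> oU; elim: n f => [|n IHn] f hf.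
  apply: (Ck_ext oU) (Ck_cst k U 0) => x _; by rewrite big_ord0.
apply: (Ck_ext oU) (CkD oU (hf ord0) (IHn _ (fun i => hf (lift ord0 i)))).
by move=> x _; rewrite big_ord_recl.
Qed.

Lemma Ck_scale (R : realType) (V W : normedModType R) k (U : set V)
    (f : V -> R) (g : V -> W) :
  open U -> Ck k U f -> Ck k U g -> Ck k U (fun x => f x *: g x).
Proof.
move=> oU; elim: k f g => [|k IHk] f g.
  by move=> cf cg x Ux; apply: cvgZ; [exact: cf|exact: cg].
move=> Cf Cg; have [df Df] := Cf; have [dg Dg] := Cg.
split=> [x Ux|v].
  by have [] := differentiable_scale 0 (df x Ux) (dg x Ux).
have := CkD oU (IHk _ _ (CkW Cf) (Dg v)) (IHk _ _ (Df v) (CkW Cg)).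
apply: (Ck_ext oU) => x Ux.
by have [_ ->] := differentiable_scale v (df x Ux) (dg x Ux).
Qed.

Lemma Ck_linear_comp (R : realType) (V W W' : normedModType R) k (U : set V)
    (l : {linear W -> W'}) (f : V -> W) :
  continuous l -> open U -> Ck k U f -> Ck k U (fun x => l (f x)).
Proof.
move=> cl oU; elim: k f => [|k IHk] f /=.
  by move=> cf x Ux; apply: continuous_comp; [exact: cf|exact: cl].
have dl y : differentiable l y by exact: linear_differentiable.
move=> [df Df]; split=> [x Ux|v].
  by apply: (@differentiable_comp _ _ _ _ f l) => //; exact: df.
apply: (Ck_ext oU) (IHk _ (Df v)) => x Ux.
rewrite !deriveE//; try exact: df.
  by rewrite (@diff_comp _ _ _ _ f l)//=; [rewrite diff_lin|exact: df].
by apply: (@differentiable_comp _ _ _ _ f l) => //; exact: df.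
Qed.

Lemma Ck_id (R : realType) (V : normedModType R) k (U : set V) :
  open U -> Ck k U (id : V -> V).
Proof.
move=> oU; case: k => [|k] /=; first by move=> x _; exact: cvg_id.
split=> [x _|v]; first exact: ex_diff.
by apply: (Ck_ext oU) (Ck_cst k U v) => x _; rewrite derive_id.
Qed.

Lemma Ck_linear (R : realType) (V W : normedModType R) k (U : set V)
    (l : {linear V -> W}) :
  continuous l -> open U -> Ck k U l.
Proof. by move=> cl oU; apply: Ck_linear_comp => //; exact: Ck_id. Qed.

(** The chain rule needs the directional derivative along a varying vector to be
    a combination of the derivatives along finitely many fixed ones. *)
Definition finite_coordinates (R : realType) (V : normedModType R) : Prop :=
  exists n (e : 'I_n -> V) (l : 'I_n -> {linear V -> R}),
    (forall i, continuous (l i)) /\ forall x, x = \sum_i l i x *: e i.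

(** By induction on k: the derivative of the composite along v is the sum of the
    products of the i-th coordinate of the derivative of g along v with the
    derivative of f along the i-th basis vector, composed with g. *)
Lemma Ck_comp (R : realType) (V V' W : normedModType R) k (U : set V)
    (U' : set V') (f : V' -> W) (g : V -> V') :
  finite_coordinates V' -> open U -> (forall x, U x -> U' (g x)) ->
  Ck k U g -> Ck k U' f -> Ck k U (fun x => f (g x)).
Proof.
move=> [n [e [l [cl lE]]]] oU gU; elim: k f g gU => [|k IHk] f g gU.
  by move=> cg cf x Ux; apply: continuous_comp; [exact: cg|exact/cf/gU].
move=> Cg Cf; have [dg Dg] := Cg; have [df Df] := Cf.
have dfg x : U x -> differentiable (fun y => f (g y)) x.
  by move=> Ux; apply: (@differentiable_comp _ _ _ _ g f);
    [exact: dg|exact/df/gU].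
split=> // v.
have C i := Ck_scale oU (Ck_linear_comp (cl i) oU (Dg v))
  (IHk _ _ gU (CkW Cg) (Df (e i))).
apply: (Ck_ext oU) (Ck_sum oU C) => x Ux.
rewrite (deriveE v (dfg x Ux)) (@diff_comp _ _ _ _ g f)//=;
  [|exact: dg|exact/df/gU].
rewrite -(deriveE v (dg x Ux)) [in RHS](lE ('D_v g x)) linear_sum/=.
by apply: eq_bigr => i _; rewrite linearZ/= (deriveE (e i) (df _ (gU _ Ux))).
Qed.

Lemma finite_coordinates_real (R : realType) : finite_coordinates R.
Proof.
exists 1%N, (fun=> 1), (fun=> idfun); split=> [_ x|x]; first exact: cvg_id.
by rewrite big_ord1 [LHS](esym (mulr1 x)).
Qed.

Lemma finite_coordinates_row (R : realType) n : finite_coordinates 'rV[R]_n.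
Proof.
pose l (i : 'I_n) (v : 'rV[R]_n) : R := v 0 i.
have ll i : linear (l i) by move=> a u v; rewrite /l !mxE.
pose lL i : {linear 'rV[R]_n -> R} :=
  HB.pack (l i) (GRing.isLinear.Build _ _ _ _ _ (ll i)).
exists n, (fun i => delta_mx 0 i), lL; split=> [i|x].
  exact: coord_continuous.
exact: row_sum_delta.
Qed.

Lemma finite_coordinates_prod (R : realType) (V W : normedModType R) :
  finite_coordinates V -> finite_coordinates W -> finite_coordinates (V * W)%type.
Proof.
move=> [n [e [l [cl lE]]]] [m [e' [l' [cl' lE']]]].
pose E (i : 'I_(n + m)) : V * W :=
  match fintype.split i with inl j => (e j, 0) | inr j => (0, e' j) end.
pose L (i : 'I_(n + m)) (x : V * W) : R :=
  match fintype.split i with inl j => l j x.1 | inr j => l' j x.2 end.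
have LL i : linear (L i).
  by move=> a x y; rewrite /L; case: (fintype.split i) => j; rewrite /= linearP.
pose LLin i : {linear (V * W)%type -> R} :=
  HB.pack (L i) (GRing.isLinear.Build _ _ _ _ _ (LL i)).
exists (n + m)%N, E, LLin; split=> [i x|[x y]].
  rewrite /LLin /= /L; case: (fintype.split i) => j.
    by apply: continuous_comp; [exact: cvg_fst|exact: cl].
  by apply: continuous_comp; [exact: cvg_snd|exact: cl'].
rewrite big_split_ord/= /E /L.
under eq_bigr do rewrite -[lshift _ _]/(unsplit (inl _)) unsplitK.
under [X in _ + X]eq_bigr do rewrite -[rshift _ _]/(unsplit (inr _)) unsplitK.
have -> : \sum_(i < n) l i x *: ((e i, 0) : V * W) = (x, 0).
  rewrite {2}(lE x); elim/big_rec2: _ => //= i a b _ ->.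
  by congr pair; rewrite /= ?scaler0 ?addr0.
have -> : \sum_(i < m) l' i y *: ((0, e' i) : V * W) = (0, y).
  rewrite {2}(lE' y); elim/big_rec2: _ => //= i a b _ ->.
  by congr pair; rewrite /= ?scaler0 ?addr0.
by congr pair; rewrite /= ?addr0 ?add0r.
Qed.

Lemma Ck_pair (R : realType) (V W W' : normedModType R) k (U : set V)
    (f : V -> W) (g : V -> W') :
  open U -> Ck k U f -> Ck k U g -> Ck k U (fun x => (f x, g x)).
Proof.
move=> oU; elim: k f g => [|k IHk] f g /=.
  by move=> cf cg x Ux; apply: cvg_pair; [exact: cf|exact: cg].
move=> [df Df] [dg Dg]; split=> [x Ux|v].
  by apply: differentiable_pair; [exact: df|exact: dg].
apply: (Ck_ext oU) (IHk _ _ (Df v) (Dg v)) => x Ux.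
rewrite (deriveE v (df x Ux)) (deriveE v (dg x Ux)) deriveE.
  by rewrite diff_pair//; [exact: df|exact: dg].
by apply: differentiable_pair; [exact: df|exact: dg].
Qed.

Lemma Cinfty_fst (R : realType) (V W : normedModType R) (U : set (V * W)) :
  open U -> Cinfty U (fst : V * W -> V).
Proof. by move=> oU k; apply: Ck_linear => // x; exact: cvg_fst. Qed.

Lemma Cinfty_snd (R : realType) (V W : normedModType R) (U : set (V * W)) :
  open U -> Cinfty U (snd : V * W -> W).
Proof. by move=> oU k; apply: Ck_linear => // x; exact: cvg_snd. Qed.

(** * A smooth step *)

(** The functions x^-n exp(-1/x), extended by zero to the left of the origin.
    The whole family is needed to see that exp(-1/x) is smooth, since the
    derivative of each member is a combination of two later ones. *)
Definition flat (R : realType) (n : nat) (x : R) : R :=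
  if 0 < x then x^-1 ^+ n * expR (- x^-1) else 0.

Lemma flat_ge0 (R : realType) n (x : R) : 0 <= flat n x.
Proof.
rewrite /flat; case: ifP => // x0.
by rewrite mulr_ge0 ?expR_ge0// exprn_ge0// invr_ge0 ltW.
Qed.

(** The exponential dominates every power, so that each member of the family
    vanishes at least linearly at the origin. *)
Lemma flat_le (R : realType) n (x : R) : flat n x <= (n.+1)`!%:R * `|x|.
Proof.
rewrite /flat; case: ifPn => x0; last by rewrite mulr_ge0.
have y0 : 0 < x^-1 by rewrite invr_gt0.
have F0 : 0 < (n.+1)`!%:R :> R by rewrite ltr0n fact_gt0.
rewrite gtr0_norm// expRN ler_pdivrMr ?expR_gt0//.
have : x^-1 ^+ n.+1 / (n.+1)`!%:R <= expR x^-1.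
  by apply: le_trans (expR_ge1Dxn n (ltW y0)); rewrite lerDr.
rewrite ler_pdivrMr// => h.
rewrite -(ler_pM2l y0) -exprS (le_trans h)//.
rewrite le_eqVlt; apply/orP; left; apply/eqP.
by field; rewrite gt_eqF.
Qed.

Lemma flat_shift (R : realType) n (x : R) : x^-1 * flat n x = flat n.+1 x.
Proof. by rewrite /flat; case: ifP; rewrite ?mulr0// exprS mulrA. Qed.

Lemma flat_is_derive (R : realType) n (x : R) :
  is_derive x 1 (flat n) (flat n.+2 x - n%:R * flat n.+1 x).
Proof.
have [x0|x0|->] := ltrgtP x 0.
- have -> : flat n.+2 x - n%:R * flat n.+1 x = 0.
    by rewrite /flat ltNge ltW//= mulr0 subr0.
  apply: (@near_eq_is_derive _ _ _ (cst 0)); near=> y.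
  rewrite /flat ltNge ltW//=; near: y; exact: lt_nbhsl.
- have x_neq0 : x != 0 by rewrite gt_eqF.
  have dV : is_derive x 1 (fun y : R => y^-1) (- x^-1 ^+ 2).
    have did : derivable (fun y : R => y) x 1 by exact: derivable_id.
    apply: DeriveDef; first exact: derivableV.
    by rewrite deriveV// derive_id exprVn /GRing.scale /= mulr1.
  have dE := @is_derive1_comp _ _ _ x _ _
    (is_derive_expR (- x^-1)) (is_deriveN dV).
  have dX := is_deriveX n dV.
  have dM := is_deriveM dX dE.
  apply: (@near_eq_is_derive _ _ _
    ((fun y : R => y^-1) ^+ n * (expR \o (- (fun y : R => y^-1))))).
    near=> y; have y0 : 0 < y by near: y; exact: lt_nbhsr.
    by rewrite /flat y0 /= !fctE.
  apply: is_derive_eq.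
  rewrite /flat x0 !fctE /GRing.scale /=.
  case: (n) => [|m] /=; first by rewrite !expr0 !mul0r !mulr0 addr0 subr0; ring.
  by rewrite !exprS; ring.
- have -> : flat n.+2 0 - n%:R * flat n.+1 0 = 0 :> R.
    by rewrite /flat ltxx mulr0 subr0.
  have lim0 : h^-1 *: ((flat n \o shift 0) (h *: 1) - flat n 0)
      @[h --> (0 : R)^'] --> (0 : R).
    have E h :
        h^-1 *: ((flat n \o shift 0) (h *: 1) - flat n 0) = flat n.+1 h :> R.
      rewrite /= addr0 {2}/flat ltxx subr0 -flat_shift.
      by rewrite /GRing.scale /= mulr1.
    under eq_fun do rewrite E.
    apply: (@squeeze_cvgr _ _ _ _ (cst 0) (fun h => (n.+2)`!%:R * `|h|)).
    + by near=> h; rewrite flat_ge0 flat_le.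
    + exact: cvg_cst.
    + apply: cvg_within_filter.
      have : (n.+2)`!%:R * `|h| @[h --> (0 : R)] --> (n.+2)`!%:R * `|0 : R|.
        by apply: cvgM; [exact: cvg_cst|apply: cvg_norm; exact: cvg_id].
      by rewrite normr0 mulr0.
  apply: DeriveDef; first by apply/cvg_ex; exists 0.
  exact: cvg_lim lim0.
Unshelve. all: by end_near. Qed.

Lemma Ck_flat (R : realType) k n : Ck k [set: R] (flat n : R -> R).
Proof.
elim: k n => [|k IHk] n /=.
  move=> x _; apply/differentiable_continuous/derivable1_diffP.
  exact: (@ex_derive _ _ _ _ _ _ _ (flat_is_derive n x)).
have df x : differentiable (flat n : R -> R) x.
  apply/derivable1_diffP; exact: (@ex_derive _ _ _ _ _ _ _ (flat_is_derive n x)).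
split=> [x _|v]; first exact: df.
have oT : open [set: R] by exact: openT.
have C1 := Ck_scale oT (Ck_cst k _ (v : R)) (IHk n.+2).
have C2 := Ck_scale oT (Ck_cst k _ (- v * n%:R : R)) (IHk n.+1).
apply: (Ck_ext oT) (CkD oT C1 C2) => x _.
rewrite deriveE// -[in RHS](mulr1 v) -[v * 1]/(v *: 1) linearZ/= -deriveE//.
rewrite (@derive_val _ _ _ _ _ _ _ (flat_is_derive n x)).
by rewrite /GRing.scale /=; ring.
Qed.

(** The inner function exp(2) exp(-1/(x - 1/4)) is zero until 1/4 and reaches 1
    at 3/4, from where on the argument of the outer [flat] is nonpositive; a step
    is thus obtained by composition alone, without dividing by a function. *)
Definition smooth_step (R : realType) (x : R) : R :=
  1 - expR 1 * flat 0 (1 - expR 2 * flat 0 (x - 1 / 4)).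

Lemma smooth_step_left (R : realType) (x : R) : x < 1 / 4 -> smooth_step x = 0.
Proof.
move=> x4; rewrite /smooth_step {2}/flat subr_gt0 ltNge (ltW x4)/= mulr0 subr0.
by rewrite /flat ltr01 expr0 mul1r invr1 expRxMexpNx_1 subrr.
Qed.

Lemma smooth_step_right (R : realType) (x : R) :
  3 / 4 < x -> smooth_step x = 1.
Proof.
move=> x4; rewrite /smooth_step.
have h : 1 <= expR 2 * flat 0 (x - 1 / 4).
  have x0 : 0 < x - 1 / 4 by lra.
  rewrite /flat x0 expr0 mul1r -expRD -{1}expR0 ler_expR subr_ge0.
  by rewrite -[leRHS]invrK lef_pV2 ?posrE ?invr_gt0//; lra.
by rewrite {1}/flat ltNge subr_le0 h/= mulr0 subr0.
Qed.

Lemma smooth_step_itv (R : realType) (x : R) : 0 <= smooth_step x <= 1.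
Proof.
rewrite /smooth_step subr_ge0 gerBl mulr_ge0 ?expR_ge0 ?flat_ge0//= andbT.
set y := 1 - _; have y1 : y <= 1.
  by rewrite gerBl mulr_ge0 ?expR_ge0 ?flat_ge0.
rewrite /flat; case: ifPn => y0; last by rewrite mulr0.
by rewrite expr0 mul1r -expRD -[leRHS]expR0 ler_expR subr_le0 invf_ge1.
Qed.

Lemma Cinfty_smooth_step (R : realType) : Cinfty [set: R] (@smooth_step R).
Proof.
move=> k; have oT : open [set: R] by exact: openT.
have fR := finite_coordinates_real R.
have C0 : Ck k [set: R] (fun x : R => x - 1 / 4).
  exact: CkD oT (Ck_id k oT) (Ck_cst k _ _).
have C1 := Ck_comp fR oT (fun _ _ => I) C0 (@Ck_flat R k 0).
have C2 := CkD oT (Ck_cst k _ (1 : R))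
  (Ck_scale oT (Ck_cst k _ (- expR 2 : R)) C1).
have C3 := Ck_comp fR oT (fun _ _ => I) C2 (@Ck_flat R k 0).
have C4 := CkD oT (Ck_cst k _ (1 : R))
  (Ck_scale oT (Ck_cst k _ (- expR 1 : R)) C3).
apply: (Ck_ext oT) C4 => x _; rewrite /smooth_step /GRing.scale /= !mulNr.
by [].
Qed.

(** * Smooth maps and thin homotopies *)

Lemma open_preimage_on (T T' : topologicalType) (O : set T) (W : set T')
    (F : T -> T') :
  open O -> open W -> (forall x, O x -> {for x, continuous F}) ->
  open (O `&` F @^-1` W).
Proof.
move=> oO oW cF; rewrite openE => x [Ox Wx]; apply: filterI.
  exact: open_nbhs_nbhs.
exact: (cF x Ox _ (open_nbhs_nbhs (conj oW Wx))).
Qed.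

Lemma smooth_on_comp (R : realType) (V V' : normedModType R) (M : manifold R)
    (O B : set V) (A : set V') (F : V -> V') (f : V' -> M) :
  finite_coordinates V' -> open O -> Cinfty O F ->
  (forall x, B x -> O x /\ A (F x)) -> smooth_on A f -> smooth_on B (f \o F).
Proof.
move=> fV' oO CF BA sf b Bb; have [Ob Ab] := BA _ Bb.
have [c [W [g [hc oW Wb Cg hg]]]] := sf _ Ab.
have oO' := open_preimage_on oO oW (CF 0%N).
exists c, (O `&` F @^-1` W), (g \o F); split=> //.
- move=> k; apply: (Ck_comp fV' oO' _ _ (Cg k)); first by move=> x [].
  by apply: Ck_subset (CF k) => x [].
- by move=> x [Ox Wx] /BA[_ Ax]; exact: hg.
Qed.

(** The chart through which the path is read is also the one in which the map is
    read, so the local representatives compose without a change of chart. *)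
Lemma smooth_on_map (R : realType) (V : normedModType R) (M N : manifold R)
    (A : set V) (p : V -> M) (f : M -> N) :
  smooth_map f -> smooth_on A p -> smooth_on A (f \o p).
Proof.
move=> sf sp a Aa; have [c [W [g [hc oW Wa Cg hg]]]] := sp _ Aa.
have [ca ga] := hg _ Wa Aa.
have Ia : chart_img c (g a) by exists (p a).
have [d [W' [g' [hd oW' Wa' Cg' hg']]]] := sf c hc _ Ia.
have oO := open_preimage_on oW oW' (Cg 0%N).
exists d, (W `&` g @^-1` W'), (g' \o g); split=> //.
- move=> k; apply: (Ck_comp (@finite_coordinates_row R _) oO _ _ (Cg' k)).
    by move=> x [].
  by apply: Ck_subset (Cg k) => x [].
- move=> x [Wx Wgx] Ax; have [cx gx] := hg _ Wx Ax.
  have Ix : chart_img c (g x) by exists (p x).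
  have := hg' _ Wgx Ix.
  by rewrite -{1 2}gx chart_mapK.
Qed.

Lemma smooth_on_eq (R : realType) (V : normedModType R) (M : manifold R)
    (A : set V) (f g : V -> M) :
  (forall x, A x -> f x = g x) -> smooth_on A f -> smooth_on A g.
Proof.
move=> fg sf a Aa; have [c [W [h [hc oW Wa Ch hh]]]] := sf _ Aa.
exists c, W, h; split=> // x Wx Ax; rewrite -fg//; exact: hh.
Qed.

Lemma smooth_on_cst (R : realType) (V : normedModType R) (M : manifold R)
    (A : set V) (x : M) : smooth_on A (fun=> x).
Proof.
move=> a _; have [c hc cx] := atlas_cover x.
exists c, setT, (fun=> chart_map c x); split=> //; first exact: openT.
by move=> k; exact: Ck_cst.
Qed.

Lemma smooth_on_local (R : realType) (V : normedModType R) (M : manifold R)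
    (A : set V) (f : V -> M) :
  (forall a, A a -> exists B, [/\ open B, B a & smooth_on (A `&` B) f]) ->
  smooth_on A f.
Proof.
move=> lf a Aa; have [B [oB Ba sf]] := lf _ Aa.
have [c [W [g [hc oW Wa Cg hg]]]] := sf a (conj Aa Ba).
exists c, (W `&` B), g; split=> //.
- exact: openI.
- by move=> k; apply: Ck_subset (Cg k) => x [].
- by move=> x [Wx Bx] Ax; exact: hg.
Qed.

Lemma smooth_on_subset (R : realType) (V : normedModType R) (M : manifold R)
    (A B : set V) (f : V -> M) :
  A `<=` B -> smooth_on B f -> smooth_on A f.
Proof.
move=> AB sf a /AB Ba; have [c [W [g [hc oW Wa Cg hg]]]] := sf _ Ba.
by exists c, W, g; split=> // x Wx /AB; exact: hg.
Qed.

(** The encoding of a path by its constant extension is smooth on the whole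
    line, which lets paths be composed with functions that leave [0,1]. *)
Lemma sitting_path_smooth (R : realType) (M : manifold R) (a : R -> M) :
  sitting_path a -> smooth_on setT a.
Proof.
move=> [sa [e [e0 e1 a0 a1]]]; apply: smooth_on_local => r _.
have [re|re] := ltP r e.
  exists [set x | x < e]; split=> //.
  apply: (smooth_on_eq _ (smooth_on_cst (a 0))) => x [_] /a0.
  by [].
have [re'|re'] := ltP (1 - e) r.
  exists [set x | 1 - e < x]; split=> //.
  apply: (smooth_on_eq _ (smooth_on_cst (a 1))) => x [_] /a1.
  by [].
exists `]0, 1[%classic; split; first exact: interval_open.
  by rewrite /= in_itv/= (lt_le_trans e0 re)/= (le_lt_trans re')// gtrBl.
apply: smooth_on_subset sa => x [_] /=; rewrite in_itv/= => /andP[x0 x1].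
by rewrite /I01 /= !ltW.
Qed.

Lemma sitting_path_map (R : realType) (M N : manifold R) (f : M -> N)
    (a : R -> M) :
  smooth_map f -> sitting_path a -> sitting_path (f \o a).
Proof.
move=> sf [sa [e [e0 e1 a0 a1]]]; split; first exact: smooth_on_map.
by exists e; split=> // r hr /=; [rewrite a0|rewrite a1].
Qed.

Lemma Cinfty_affine (R : realType) (p q : R) :
  Cinfty [set: R] (fun r => p * r + q).
Proof.
move=> k; have oT : open [set: R] by exact: openT.
exact: CkD oT (Ck_scale oT (Ck_cst k _ p) (Ck_id k oT)) (Ck_cst k _ q).
Qed.

Lemma sitting_path_affine (R : realType) (M : manifold R) (a : R -> M)
    (p q : R) :
  1 <= p -> q <= 0 -> 1 <= p + q -> sitting_path a ->
  sitting_path (fun r => a (p * r + q)).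
Proof.
move=> p1 q0 pq1 sp; have sa := sitting_path_smooth sp.
have [e [e0 e1 a0 a1]] := proj2 sp.
have p0 : 0 < p by lra.
have ep : e / p * p = e by rewrite divfK ?gt_eqF.
split.
  have CA := Cinfty_affine p q.
  by apply: smooth_on_comp (finite_coordinates_real R) openT CA _ sa.
have e'0 : 0 < e / p by rewrite divr_gt0.
exists (e / p); split=> // [|r hr|r hr].
- by rewrite ltr_pdivrMr//; lra.
- by rewrite a0 ?[RHS]a0//; nra.
- by rewrite a1 ?[RHS]a1//; nra.
Qed.

Lemma rank_proportional_rows (F : fieldType) n (s t : F) (w : 'rV[F]_n) :
  (\rank (col_mx (s *: w) (t *: w)) <= 1)%N.
Proof.
rewrite -(mul_scalar_mx s) -(mul_scalar_mx t) -mul_col_mx.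
exact: leq_trans (mxrankM_maxr _ _) (rank_leq_row _).
Qed.

(** A map from the plane that factors through the line has a differential of
    rank at most one, so that a reparametrisation of a path is thin homotopic
    to it: interpolate between the two parameters. The conditions on p and q
    keep the interpolated parameter below p r' and above 1 - p (1 - r'), where
    the path is still sitting when r' is near 0 or near 1. *)
Lemma thin_homotopic_affine (R : realType) (M : manifold R) (a : R -> M)
    (p q : R) :
  1 <= p -> q <= 0 -> 1 <= p + q -> sitting_path a ->
  thin_homotopic a (fun r => a (p * r + q)).
Proof.
move=> p1 q0 pq1 sp; have sa := sitting_path_smooth sp.
have [e [e0 e1 a0 a1]] := proj2 sp.
have p0 : 0 < p by lra.
have ep : e / p * p = e by rewrite divfK ?gt_eqF.
have e'0 : 0 < e / p by rewrite divr_gt0.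
split=> //; first exact: sitting_path_affine.
- by rewrite mulr0 add0r [RHS]a0//; lra.
- by rewrite mulr1 [RHS]a1//; lra.
(* From the parameter z.2, when z.1 is near 0, to p z.2 + q, when it is near 1. *)
pose phi (z : R * R) : R := z.2 + smooth_step z.1 * ((p - 1) * z.2 + q).
have oT : open [set: R * R] by exact: openT.
have fR := finite_coordinates_real R.
have Cphi : Cinfty [set: R * R] phi.
  move=> k; have C1 := Ck_comp fR oT (fun _ _ => I) (@Cinfty_fst R R R _ oT k)
    (@Cinfty_smooth_step R k).
  have C2 := @Cinfty_snd R R R _ oT k.
  have C3 := Ck_comp fR oT (fun _ _ => I) C2 (@Cinfty_affine R (p - 1) q k).
  exact: CkD oT C2 (Ck_scale oT C1 C3).
exists (a \o phi); split.
- exact: smooth_on_comp fR oT Cphi _ sa.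
- move=> z _; have [c [W [g [hc oW Wz Cg hg]]]] := sa (phi z) I.
  have oO : open (phi @^-1` W).
    rewrite -[X in open X]setTI; exact: open_preimage_on oT oW (Cphi 0%N).
  exists c, (phi @^-1` W), (g \o phi); split.
    split=> //; last by move=> x Wx _; exact: hg.
    move=> k; apply: (Ck_comp fR oO _ _ (Cg k)) => //.
    exact: Ck_subset (Cphi k).
  have dphi : differentiable phi z by have [/(_ z I)] := Cphi 1%N.
  have dg : differentiable g (phi z) by have [/(_ _ Wz)] := Cg 1%N.
  have DE v : 'D_v (g \o phi) z = 'D_v phi z *: 'D_1 g (phi z).
    rewrite !deriveE//; last exact: differentiable_comp.
    by rewrite diff_comp//= -linearZ/= [_ *: 1]mulr1.
  rewrite !DE; exact: rank_proportional_rows.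
have st0 := @smooth_step_itv R.
exists (Num.min (e / p) (1 / 4)); split.
- by rewrite lt_min e'0; lra.
- by rewrite gt_min; apply/orP; right; lra.
- move=> r r' _ /andP[r0 r1]; rewrite lt_min => /andP[hr _] /=.
  have /andP[s0 s1] := st0 r; rewrite a0// /phi /=.
  have : p * r' < e by rewrite -ep mulrC ltr_pM2r//.
  have A0 : 0 <= (p - 1) * r' by rewrite mulr_ge0 ?subr_ge0.
  have sA : smooth_step r * ((p - 1) * r') <= (p - 1) * r' by exact: ler_piMl.
  have sq : smooth_step r * q <= 0 by exact: mulr_ge0_le0.
  lra.
- move=> r r' _ /andP[r0 r1]; rewrite ltrBlDr -ltrBlDl lt_min => /andP[hr _] /=.
  have /andP[s0 s1] := st0 r; rewrite a1// /phi /=.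
  have : p * (1 - r') < e by rewrite -ep mulrC ltr_pM2r//.
  have A0 : 0 <= (p - 1) * (1 - r') by rewrite mulr_ge0 ?subr_ge0.
  have sA : smooth_step r * ((p - 1) * (1 - r')) <= (p - 1) * (1 - r').
    exact: ler_piMl.
  have sq : 0 <= smooth_step r * (p + q - 1) by apply: mulr_ge0 => //; lra.
  lra.
- split=> r r' _ _.
    rewrite lt_min => /andP[_ hr]; rewrite /phi /= smooth_step_left//.
    by rewrite mul0r addr0.
  rewrite ltrBlDr -ltrBlDl lt_min => /andP[_ hr].
  rewrite /phi /= smooth_step_right; last lra.
  by congr a; ring.
Qed.

(** * Entries of lazy paths *)

Lemma lazy_path_inj (R : realType) (X : lie_groupoid R) (G G' : lazy_path X) :
  lp_raw G = lp_raw G' -> G = G'.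
Proof.
case: G G' => [r h] [r' h'] /= e; subst r'; congr LazyPath.
exact: Prop_irrelevance.
Qed.

Lemma thin_classP (R : realType) (X : lie_groupoid R) (G G' : lazy_path X) :
  thin_class G = thin_class G' <-> lazy_thin G G'.
Proof.
split=> [/eqquotP|h]; first by rewrite /= => /asboolP.
by apply/eqquotP/asboolP.
Qed.

Lemma lazy_move_class (R : realType) (X : lie_groupoid R) (G G' : lazy_path X) :
  lazy_move G G' -> thin_class G = thin_class G'.
Proof. by move=> m; apply/thin_classP/rst_step; left. Qed.

Lemma lp_tgtE (R : realType) (X : lie_groupoid R) (G : raw_lazy X) :
  lp_tgt G = lg_tgt (lp_arr (lp_order G) G).
Proof. by rewrite /lp_tgt /lp_arr /lp_order (last_nth G.1) size_map. Qed.

Lemma lazy_chain_nth (R : realType) (X : lie_groupoid R) (G : lazy_path X) i :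
  (i < lp_order G)%N ->
  [/\ sitting_path (lp_path i G), lg_tgt (lp_arr i G) = lp_path i G 0 &
      lg_src (lp_arr i.+1 G) = lp_path i G 1].
Proof.
case: G => -[g l] /=; rewrite /lp_path /lp_arr /lp_order /=.
move: (path_const _ _) => d; move: {2 4}g => d'.
elim: l g i => [|[a g1] l IHl] g [|i] //= [sa h0 h1 hl] hi; first by split.
have [? ? ?] := IHl g1 i hl hi; split=> //.
Qed.

(** * Ends of lazy paths *)

Lemma lazy_move_ends (R : realType) (X : lie_groupoid R) (G G' : raw_lazy X) :
  lazy_move G G' -> lazy_chain G.1 G.2 -> lazy_chain G'.1 G'.2 ->
  lp_src G = lp_src G' /\ lp_tgt G = lp_tgt G'.
Proof.
have gX := lg_groupoid X.
elim=> {G G'} /= [g g' a l ca|g g' x a b l|g g' z l _|g g1 g2 a l1 l2 _ IH].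
- move=> [_ h0 h1 _] _; rewrite /lp_src /lp_tgt /=.
  have e : lg_src g' = lg_tgt g by rewrite h0 h1.
  rewrite (gpd_src_comp gX)//; split=> //.
  by case: l => //=; rewrite (gpd_tgt_comp gX).
- by [].
- move=> [_ h0 h1 _] _; rewrite /lp_src /lp_tgt /=.
  rewrite (gpd_src_comp gX)//; split=> //.
  by case: l => //=; rewrite (gpd_tgt_comp gX)// (gpd_tgt_inv gX).
- by move=> [_ _ _ h1] [_ _ _ h2]; have [_] := IH h1 h2.
Qed.

Lemma thin_deformation_ends (R : realType) (X : lie_groupoid R)
    (G G' : raw_lazy X) :
  thin_deformation G G' -> lp_src G = lp_src G' /\ lp_tgt G = lp_tgt G'.
Proof.
move=> [n [z [hz _ c0 cn]]]; rewrite !lp_tgtE -n.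
have [_ e0 e1] := hz 0%N (leq0n _); have [_ f0 f1] := hz _ (leqnn _).
split; last by rewrite -f0 -f1; exact: cn.
by rewrite /lp_src -[G.1]/(lp_arr 0 G) -[G'.1]/(lp_arr 0 G') -e0 -e1; exact: c0.
Qed.

Lemma lazy_thin_ends (R : realType) (X : lie_groupoid R) (G G' : lazy_path X) :
  lazy_thin G G' -> lp_src G = lp_src G' /\ lp_tgt G = lp_tgt G'.
Proof.
elim=> {G G'} [G G' [|]|G|G G' _ [-> ->]|G1 G2 G3 _ [-> ->] _ []] //.
- by move/lazy_move_ends; apply; exact: lp_chain.
- exact: thin_deformation_ends.
Qed.

(** * Joining lazy paths by a constant path *)

(** Composition in the thin fundamental groupoid up to one removal of a constant
    path. Unlike the composition of lazy paths, which composes the arrows where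
    they meet, joining leaves both sequences intact, so that moves, deformations
    and plots of the two factors extend to it entry by entry. *)
Definition raw_join (R : realType) (X : lie_groupoid R) (G' G : raw_lazy X)
  : raw_lazy X := (G.1, G.2 ++ (path_const R (lp_tgt G), G'.1) :: G'.2).

Lemma lazy_chain_cat (R : realType) (X : lie_groupoid R) g l a g' l' :
  @lazy_chain R X g l -> lazy_chain g' l' -> sitting_path a ->
  lg_tgt (last g (unzip2 l)) = a 0 -> lg_src g' = a 1 ->
  lazy_chain g (l ++ (a, g') :: l').
Proof.
move=> hl hl' sa h1 h0; elim: l g hl h1 => [|[b g1] l IHl] g //=.
by move=> [? ? ? hl] h; split=> //; exact: IHl.
Qed.

Lemma raw_join_chain (R : realType) (X : lie_groupoid R) (G' G : lazy_path X) :
  lp_tgt G = lp_src G' -> lazy_chain (raw_join G' G).1 (raw_join G' G).2.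
Proof.
move=> h; apply: lazy_chain_cat; [exact: lp_chain|exact: lp_chain| |by []|].
  exact: sitting_path_const.
by rewrite /path_const h.
Qed.

Definition lp_join (R : realType) (X : lie_groupoid R) (G' G : lazy_path X)
  (h : lp_tgt G = lp_src G') : lazy_path X := LazyPath (raw_join_chain h).

Lemma lazy_move_join_comp (R : realType) (X : lie_groupoid R)
    (G' G : raw_lazy X) : lazy_move (raw_join G' G) (raw_comp G' G).
Proof.
case: G => g l; rewrite /raw_join /raw_comp /=; move: (lp_tgt _) => y.
elim: l g => [|[a g1] l IHl] g /=; first exact: move_constant.
by apply: move_cons; rewrite -surjective_pairing.
Qed.

Lemma thin_class_join (R : realType) (X : lie_groupoid R) (G' G : lazy_path X)
    (h : lp_tgt G = lp_src G') :
  thin_class (lp_join h) = thin_class (lp_comp h).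
Proof. by apply: lazy_move_class; exact: lazy_move_join_comp. Qed.

Lemma lp_tgt_join (R : realType) (X : lie_groupoid R) (G' G : raw_lazy X) :
  lp_tgt (raw_join G' G) = lp_tgt G'.
Proof. by rewrite /lp_tgt /raw_join /unzip2 map_cat last_cat. Qed.

Lemma lazy_move_joinr (R : realType) (X : lie_groupoid R)
    (H G G' : raw_lazy X) :
  lazy_move G G' -> lp_tgt G = lp_tgt G' ->
  lazy_move (raw_join H G) (raw_join H G').
Proof.
rewrite /raw_join => m <-; move: (_ :: _) => s.
elim: m => {G G'} *; [exact: move_constant|exact: move_identity|
  exact: move_conjugate|exact: move_cons].
Qed.

Lemma lazy_move_joinl (R : realType) (X : lie_groupoid R)
    (H G G' : raw_lazy X) :
  lazy_move G G' -> lazy_move (raw_join G H) (raw_join G' H).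
Proof.
case: H G G' => [h m] [g l] [g' l'] mv; rewrite /raw_join /=.
move: (path_const _ _) => c.
by elim: m h => [|[a h1] m IHm] h; exact: move_cons.
Qed.

Lemma lp_order_join (R : realType) (X : lie_groupoid R) (G' G : raw_lazy X) :
  lp_order (raw_join G' G) = (lp_order G + (lp_order G').+1)%N.
Proof. by rewrite /lp_order size_cat. Qed.

Lemma lp_arr_join (R : realType) (X : lie_groupoid R) (G' G : raw_lazy X) i :
  (i <= lp_order (raw_join G' G))%N ->
  lp_arr i (raw_join G' G) =
    if (i <= lp_order G)%N then lp_arr i G
    else lp_arr (i - (lp_order G).+1) G'.
Proof.
rewrite lp_order_join /lp_arr /raw_join /lp_order /= => hi.
rewrite /unzip2 map_cat -cat_cons nth_cat /= size_map ltnS.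
case: ifPn => // h; apply: set_nth_default; rewrite /= size_map.
by rewrite -ltnNge in h; rewrite ltn_subLR// addSn ltnS.
Qed.

Lemma lp_path_join (R : realType) (X : lie_groupoid R) (G' G : raw_lazy X) i :
  (i < lp_order (raw_join G' G))%N ->
  lp_path i (raw_join G' G) =
    if (i < lp_order G)%N then lp_path i G
    else if i == lp_order G then path_const R (lp_tgt G)
    else lp_path (i - (lp_order G).+1) G'.
Proof.
rewrite lp_order_join /lp_path /raw_join /lp_order /= => hi.
rewrite /unzip1 map_cat nth_cat size_map.
case: ifPn => h //=; rewrite -leqNgt in h.
case: eqVneq => [->|ne]; first by rewrite subnn.
have lt : (size G.2 < i)%N by rewrite ltn_neqAle eq_sym ne.
rewrite subnS -[in LHS](@prednK (i - _)) ?subn_gt0//=.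
apply: set_nth_default; rewrite size_map -subnS ltn_subLR//.
by rewrite addSn -ltnS -addnS.
Qed.

(** Adding constant paths at both ends is the reparametrisation 4 r - 2: the
    path, followed beyond its ends, already is constant there. This is the
    condition of a thin deformation on a path between arrows that stay put. *)
Lemma thin_homotopic_sandwich (R : realType) (M : manifold R)
    (a b c : R -> M) :
  sitting_path a -> is_constant b -> b 0 = a 0 -> is_constant c -> c 0 = a 1 ->
  thin_homotopic a (path_cat (path_cat (path_rev c) a) b).
Proof.
move=> sa cb b0 cc c1; have [e [e0 e1 a0 a1]] := proj2 sa.
have -> : path_cat (path_cat (path_rev c) a) b = (fun r => a (4 * r + (- 2))).
  apply/funext => r; rewrite /path_cat /path_rev; case: ifPn => [hr|].
    by rewrite a0; [rewrite -b0; exact: cb|lra].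
  rewrite -ltNge => hr; case: ifPn => [_|]; first by congr a; ring.
  by rewrite -ltNge => hr'; rewrite [RHS]a1; [rewrite -c1; exact: cc|lra].
by apply: thin_homotopic_affine => //; lra.
Qed.

Lemma thin_deformation_refl (R : realType) (X : lie_groupoid R)
    (G : lazy_path X) : thin_deformation G G.
Proof.
split=> //; exists (fun i _ => lp_arr i G); split=> // i hi.
  by split=> //; exact: sitting_path_const.
have [sa h0 h1] := lazy_chain_nth hi.
exact: thin_homotopic_sandwich.
Qed.

(** The two deformations are run side by side. They fit together at the joining
    constant path because the end of the one and the beginning of the other
    keep their target and source fixed. *)
Lemma thin_deformation_join (R : realType) (X : lie_groupoid R)
    (G1 G2 H1 H2 : lazy_path X) :
  lp_tgt G1 = lp_src H1 -> thin_deformation G1 G2 -> thin_deformation H1 H2 ->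
  thin_deformation (raw_join H1 G1) (raw_join H2 G2).
Proof.
move=> h dG dH.
have [_ tG] := thin_deformation_ends dG.
move: dG dH => [nG [z [hz pz cz0 czn]]] [nH [w [hw pw cw0 cwn]]].
have ord : lp_order (raw_join H1 G1) = lp_order (raw_join H2 G2).
  by rewrite !lp_order_join nG nH.
split=> //.
exists (fun i => if (i <= lp_order G1)%N then z i
  else w (i - (lp_order G1).+1)%N).
split.
- move=> i hi; rewrite !lp_arr_join// -?ord// -nG; case: ifPn => hiG.
    exact: hz.
  apply: hw; rewrite -ltnNge in hiG.
  by rewrite leq_subLR addSn -addnS -lp_order_join.
- move=> i hi; rewrite !lp_path_join// -?ord// -nG -tG.
  have [hiG|hiG] := ltnP i (lp_order G1); first by rewrite (ltnW hiG); exact: pz.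
  have [iE|ne] := eqVneq i (lp_order G1).
    rewrite iE leqnn subnn; apply: thin_homotopic_sandwich => //.
    - exact: sitting_path_const.
    - have [_ e0 _] := hz _ (leqnn (lp_order G1)).
      by rewrite /= e0 /path_const lp_tgtE.
    - have [_ e0 _] := hw _ (leq0n (lp_order H1)).
      by rewrite /= e0 /path_const h.
  have lt : (lp_order G1 < i)%N by rewrite ltn_neqAle eq_sym ne.
  rewrite leqNgt lt /= subSn//.
  apply: pw; rewrite ltn_subLR//.
  by rewrite addSn -addnS -lp_order_join.
- exact: cz0.
- rewrite lp_order_join leqNgt addnS ltnS leq_addr /=.
  by rewrite subSS addKn.
Qed.

Lemma lazy_thin_joinr (R : realType) (X : lie_groupoid R)
    (H G G' : lazy_path X) (h : lp_tgt G = lp_src H) (h' : lp_tgt G' = lp_src H) :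
  lazy_thin G G' -> lazy_thin (lp_join h) (lp_join h').
Proof.
move=> t; elim: t h h' => {G G'} [G G' s|G|G G' _ IH|G1 G2 G3 s1 IH1 s2 IH2] h h'.
- apply: rst_step; case: s => [m|d]; [left|right].
    by apply: lazy_move_joinr; rewrite ?h.
  exact: thin_deformation_join d (thin_deformation_refl H).
- by rewrite (Prop_irrelevance h h'); exact: rst_refl.
- exact/rst_sym/IH.
- have h2 : lp_tgt G2 = lp_src H by have [_ <-] := lazy_thin_ends s1.
  exact: rst_trans (IH1 h h2) (IH2 h2 h').
Qed.

Lemma lazy_thin_joinl (R : realType) (X : lie_groupoid R)
    (H G G' : lazy_path X) (h : lp_tgt H = lp_src G) (h' : lp_tgt H = lp_src G') :
  lazy_thin G G' -> lazy_thin (lp_join h) (lp_join h').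
Proof.
move=> t; elim: t h h' => {G G'} [G G' s|G|G G' _ IH|G1 G2 G3 s1 IH1 s2 IH2] h h'.
- apply: rst_step; case: s => [m|d]; [left|right].
    exact: lazy_move_joinl.
  exact: thin_deformation_join (thin_deformation_refl H) d.
- by rewrite (Prop_irrelevance h h'); exact: rst_refl.
- exact/rst_sym/IH.
- have h2 : lp_tgt H = lp_src G2 by have [<- _] := lazy_thin_ends s1.
  exact: rst_trans (IH1 h h2) (IH2 h2 h').
Qed.

(** * The groupoid of classes *)

Definition thin_src (R : realType) (X : lie_groupoid R) (a : thin_arr X)
  : lg_ob X := lp_src (repr a).

Definition thin_tgt (R : realType) (X : lie_groupoid R) (a : thin_arr X)
  : lg_ob X := lp_tgt (repr a).

Definition thin_unit (R : realType) (X : lie_groupoid R) (x : lg_ob X)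
  : thin_arr X := thin_class (lp_unit x).

Definition thin_inv (R : realType) (X : lie_groupoid R) (a : thin_arr X)
  : thin_arr X := thin_class (lp_inv (repr a)).

(** Classes that do not meet have no composite; the value there is arbitrary. *)
Definition thin_comp (R : realType) (X : lie_groupoid R) (b a : thin_arr X)
  : thin_arr X :=
  if pselect (lp_tgt (repr a) = lp_src (repr b)) is left h
  then thin_class (lp_comp h) else a.

Lemma thin_class_repr (R : realType) (X : lie_groupoid R) (a : thin_arr X) :
  thin_class (repr a) = a.
Proof. exact: reprK. Qed.

Lemma lazy_thin_repr (R : realType) (X : lie_groupoid R) (G : lazy_path X) :
  lazy_thin (repr (thin_class G)) G.
Proof. by apply/thin_classP; rewrite thin_class_repr. Qed.

Lemma thin_src_class (R : realType) (X : lie_groupoid R) (G : lazy_path X) :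
  thin_src (thin_class G) = lp_src G.
Proof. by have [] := lazy_thin_ends (lazy_thin_repr G). Qed.

Lemma thin_tgt_class (R : realType) (X : lie_groupoid R) (G : lazy_path X) :
  thin_tgt (thin_class G) = lp_tgt G.
Proof. by have [] := lazy_thin_ends (lazy_thin_repr G). Qed.

Lemma thin_comp_join (R : realType) (X : lie_groupoid R) (G' G : lazy_path X)
    (h : lp_tgt G = lp_src G') :
  thin_comp (thin_class G') (thin_class G) = thin_class (lp_join h).
Proof.
rewrite /thin_comp; case: pselect => [h1|]; last first.
  by rewrite -/(thin_src _) -/(thin_tgt _) thin_src_class thin_tgt_class.
have h2 : lp_tgt G = lp_src (repr (thin_class G')).
  by rewrite -/(thin_src _) thin_src_class.
rewrite -thin_class_join; apply/thin_classP.
apply: rst_trans (lazy_thin_joinr h1 h2 (lazy_thin_repr G)) _.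
exact: lazy_thin_joinl (lazy_thin_repr G').
Qed.

Lemma thin_comp_class (R : realType) (X : lie_groupoid R) (G' G : lazy_path X)
    (h : lp_tgt G = lp_src G') :
  thin_comp (thin_class G') (thin_class G) = thin_class (lp_comp h).
Proof. by rewrite thin_comp_join thin_class_join. Qed.

Lemma thin_src_unit (R : realType) (X : lie_groupoid R) (x : lg_ob X) :
  thin_src (thin_unit x) = x.
Proof.
by rewrite /thin_unit thin_src_class; exact: gpd_src_unit (lg_groupoid X) x.
Qed.

Lemma thin_tgt_unit (R : realType) (X : lie_groupoid R) (x : lg_ob X) :
  thin_tgt (thin_unit x) = x.
Proof.
by rewrite /thin_unit thin_tgt_class; exact: gpd_tgt_unit (lg_groupoid X) x.
Qed.

Lemma thin_src_comp (R : realType) (X : lie_groupoid R) (b a : thin_arr X) :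
  thin_src b = thin_tgt a -> thin_src (thin_comp b a) = thin_src a.
Proof.
rewrite -[a]thin_class_repr -[b]thin_class_repr !thin_src_class thin_tgt_class.
by move=> /esym h; rewrite (thin_comp_join h) thin_src_class.
Qed.

Lemma thin_tgt_comp (R : realType) (X : lie_groupoid R) (b a : thin_arr X) :
  thin_src b = thin_tgt a -> thin_tgt (thin_comp b a) = thin_tgt b.
Proof.
rewrite -[a]thin_class_repr -[b]thin_class_repr !thin_src_class !thin_tgt_class.
move=> /esym h; rewrite (thin_comp_join h) thin_tgt_class; exact: lp_tgt_join.
Qed.

Lemma thin_compA (R : realType) (X : lie_groupoid R) (c b a : thin_arr X) :
  thin_src c = thin_tgt b -> thin_src b = thin_tgt a ->
  thin_comp c (thin_comp b a) = thin_comp (thin_comp c b) a.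
Proof.
rewrite -[a]thin_class_repr -[b]thin_class_repr -[c]thin_class_repr.
rewrite !thin_src_class !thin_tgt_class => /esym hcb /esym hba.
rewrite (thin_comp_join hba) (thin_comp_join hcb).
have hl : lp_tgt (lp_join hba) = lp_src (repr c).
  by rewrite -hcb; exact: lp_tgt_join.
have hr : lp_tgt (repr a) = lp_src (lp_join hcb) by [].
rewrite (thin_comp_join hl) (thin_comp_join hr); congr thin_class.
apply: lazy_path_inj; rewrite /= /raw_join /=; congr pair.
by rewrite -catA /= lp_tgt_join.
Qed.

Lemma raw_comp_unit (R : realType) (X : lie_groupoid R) y m
    (G : raw_lazy X) :
  lp_tgt G = y -> raw_comp (lg_unit y, m) G = (G.1, G.2 ++ m).
Proof.
case: G => g l; rewrite /lp_tgt /raw_comp /=.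
elim: l g => [|[a g1] l IHl] g /= h.
  by rewrite -h (gpd_comp_unitl (lg_groupoid X)).
by rewrite IHl.
Qed.

Lemma thin_comp_unitl (R : realType) (X : lie_groupoid R) (a : thin_arr X) :
  thin_comp (thin_unit (thin_tgt a)) a = a.
Proof.
rewrite -[X in thin_comp _ X]thin_class_repr /thin_unit.
move: (repr a) (thin_class_repr a) => G Ga.
have h : lp_tgt G = lp_src (lp_unit (thin_tgt a)).
  by rewrite /lp_src /= (gpd_src_unit (lg_groupoid X)) -Ga thin_tgt_class.
rewrite (thin_comp_class h) -[RHS]Ga; apply: lazy_move_class => /=.
have y : lp_tgt G = thin_tgt a by rewrite -Ga thin_tgt_class.
rewrite raw_comp_unit// -y.
case: (lp_raw G) => g l; rewrite /lp_tgt /=.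
elim: l g => [|[b g1] l IHl] g /=; last exact: move_cons.
rewrite -[in X in lazy_move _ X](gpd_comp_unitl (lg_groupoid X) g).
by apply: move_constant => r r'.
Qed.

Lemma thin_comp_unitr (R : realType) (X : lie_groupoid R) (a : thin_arr X) :
  thin_comp a (thin_unit (thin_src a)) = a.
Proof.
rewrite -[X in thin_comp X _]thin_class_repr /thin_unit.
move: (repr a) (thin_class_repr a) => G Ga.
have h : lp_tgt (lp_unit (thin_src a)) = lp_src G.
  by rewrite /lp_tgt /= (gpd_tgt_unit (lg_groupoid X)) -Ga thin_src_class.
rewrite (thin_comp_class h) -[RHS]Ga; apply: lazy_move_class => /=.
have -> : thin_src a = lp_src G by rewrite -Ga thin_src_class.
case: (lp_raw G) => g l; rewrite /lp_src /raw_comp /=.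
have gX := lg_groupoid X; rewrite (gpd_comp_unitr gX).
rewrite -[in X in lazy_move _ X](gpd_comp_unitr gX g).
by apply: move_constant => r r'.
Qed.

(** * Inverses *)

Lemma raw_inv_rec_split (R : realType) (X : lie_groupoid R) g l m m' :
  @raw_inv_rec R X g l (m ++ m') =
  ((raw_inv_rec g l m).1, (raw_inv_rec g l m).2 ++ m').
Proof. by elim: l g m => //= -[a g1] l IHl g m; rewrite -cat_cons IHl. Qed.

Lemma raw_invK (R : realType) (X : lie_groupoid R) (G : raw_lazy X) :
  raw_inv (raw_inv G) = G.
Proof.
have gX := lg_groupoid X.
have invK (g : lg_arr X) : lg_inv (lg_inv g) = g.
  rewrite -[LHS](gpd_comp_unitr gX) (gpd_src_inv gX) (gpd_tgt_inv gX).
  rewrite -(gpd_comp_invl gX) (gpd_compA gX) ?(gpd_src_inv gX)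
    ?(gpd_tgt_inv gX)//.
  by rewrite (gpd_comp_invl gX) (gpd_src_inv gX) (gpd_comp_unitl gX).
have revK (a : R -> lg_ob X) : path_rev (path_rev a) = a.
  by apply/funext => r; rewrite /path_rev subKr.
suff E g l acc acc' : let r := @raw_inv_rec R X g l acc in
    raw_inv_rec r.1 r.2 acc' = raw_inv_rec (lg_inv g) acc (l ++ acc').
  by case: G => g l; rewrite /raw_inv E /= invK cats0.
elim: l g acc acc' => [|[a g1] l IHl] g acc acc' //=.
by rewrite IHl /= revK invK.
Qed.

Lemma raw_inv_entries (R : realType) (X : lie_groupoid R) (G : raw_lazy X) :
  (raw_inv G).1 :: unzip2 (raw_inv G).2 = rev (map lg_inv (G.1 :: unzip2 G.2)) /\
  unzip1 (raw_inv G).2 = rev (map (@path_rev R _) (unzip1 G.2)).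
Proof.
case: G => g l; rewrite /raw_inv /=.
suff E acc : let r := @raw_inv_rec R X g l acc in
    r.1 :: unzip2 r.2 = rev (map lg_inv (g :: unzip2 l)) ++ unzip2 acc /\
    unzip1 r.2 = rev (map (@path_rev R _) (unzip1 l)) ++ unzip1 acc.
  by have := E [::]; rewrite /= !cats0.
elim: l g acc => [|[a g1] l IHl] g acc //=.
have [e1 e2] := IHl g1 ((path_rev a, lg_inv g) :: acc).
by rewrite e1 e2 /= !rev_cons -!cats1 -!catA.
Qed.

Lemma lp_order_inv (R : realType) (X : lie_groupoid R) (G : raw_lazy X) :
  lp_order (raw_inv G) = lp_order G.
Proof.
have [_ /(congr1 size)] := raw_inv_entries G.
by rewrite size_rev !size_map.
Qed.

Lemma lp_arr_inv (R : realType) (X : lie_groupoid R) (G : raw_lazy X) i :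
  (i <= lp_order G)%N ->
  lp_arr i (raw_inv G) = lg_inv (lp_arr (lp_order G - i) G).
Proof.
rewrite /lp_arr /lp_order => hi; have [-> _] := raw_inv_entries G.
set s := _ :: _; have sz : size s = (size G.2).+1 by rewrite /= size_map.
by rewrite nth_rev size_map sz// subSS (nth_map G.1)// sz ltnS leq_subr.
Qed.

Lemma lp_path_inv (R : realType) (X : lie_groupoid R) (G : raw_lazy X) i :
  (i < lp_order G)%N ->
  lp_path i (raw_inv G) = path_rev (lp_path (lp_order G - i.+1) G).
Proof.
rewrite /lp_path /lp_order => hi; have [_ ->] := raw_inv_entries G.
rewrite nth_rev ?size_map// (nth_map (path_const R (lg_tgt G.1))) ?size_map//.
by rewrite -subSn// subSS leq_subr.
Qed.

Lemma lp_src_inv (R : realType) (X : lie_groupoid R) (G : raw_lazy X) :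
  lp_src (raw_inv G) = lp_tgt G.
Proof.
rewrite lp_tgtE /lp_src -[(raw_inv G).1]/(lp_arr 0 (raw_inv G)) lp_arr_inv//.
by rewrite subn0 (gpd_src_inv (lg_groupoid X)).
Qed.

Lemma lp_tgt_inv (R : realType) (X : lie_groupoid R) (G : raw_lazy X) :
  lp_tgt (raw_inv G) = lp_src G.
Proof. by rewrite -[in RHS](raw_invK G) lp_src_inv. Qed.

Lemma thin_unit_arrow (R : realType) (X : lie_groupoid R) (x : lg_ob X)
    (G : lazy_path X) :
  lp_raw G = (lg_unit x, [::]) -> thin_class G = thin_unit x.
Proof.
move=> GE; apply/esym/lazy_move_class; rewrite GE.
have gX := lg_groupoid X.
rewrite -[in X in lazy_move _ X](gpd_comp_unitr gX (lg_unit x)).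
rewrite (gpd_src_unit gX).
by apply: move_constant => r r'.
Qed.

(** The case of order one of the inverse law. The middle arrow, an identity at
    the end of a, is dragged back along a by a thin deformation; both paths
    shrink to constants, since what they lose is exactly what the source and
    target of the deformation restore. *)
Lemma lazy_thin_backtrack (R : realType) (X : lie_groupoid R)
    (G : lazy_path X) (g : lg_arr X) (a : R -> lg_ob X) :
  lp_raw G = (g, [:: (a, lg_unit (a 1)); (path_rev a, lg_inv g)]) ->
  thin_class G = thin_unit (lg_src g).
Proof.
have gX := lg_groupoid X; move=> GE.
have [sa h0] : sitting_path a /\ lg_tgt g = a 0.
  by have := lp_chain G; rewrite GE /= => -[].
have sra := sitting_path_rev sa.
pose c := path_const R (a 0).
have chc : lazy_chain g [:: (c, lg_unit (a 0)); (c, lg_inv g)].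
  split=> //; first exact: sitting_path_const.
    exact: (gpd_src_unit gX).
  split=> //; first exact: sitting_path_const.
    exact: (gpd_tgt_unit gX).
  by rewrite (gpd_src_inv gX).
pose G1 : lazy_path X := LazyPath (chc : lazy_chain (_, _).1 (_, _).2).
(* What is required of a is to be thin homotopic to two constant paths followed
   by a, which is a at the parameter 4 r - 3; its reverse is compared with itself
   followed by constant paths, at the parameter 2 r. *)
have t1 : lazy_thin G G1.
  apply: rst_step; right; rewrite GE; split=> //.
  exists (fun i => match i with
    | 0 => fun=> g | 1 => lg_unit \o path_rev a | _ => fun=> lg_inv g end).
  split=> //.
  - case=> [|[|[|//]]] _; split=> //=; try exact: sitting_path_const.
    + exact: sitting_path_map (@lg_unit_smooth R X) sra.
    + by rewrite /path_rev subr0.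
    + by rewrite /path_rev subrr.
  - have [e [e0 e1 a0 a1]] := proj2 sa.
    case=> [|[|//]] _ /=; rewrite /lp_path /=.
    + have -> : path_cat (path_cat (path_rev (lg_src \o (lg_unit \o path_rev a)))
          c) (lg_tgt \o (fun=> g)) = (fun r => a (4 * r + (- 3))).
        apply/funext => r; rewrite /path_cat; case: ifPn => [hr|].
          by rewrite a0 /=; [|lra].
        rewrite -ltNge => hr; case: ifPn => [hr'|_].
          by rewrite a0 /c /path_const; [|lra].
        rewrite /path_rev /= (gpd_src_unit gX); congr a; ring.
      by apply: thin_homotopic_affine => //; lra.
    + have -> : path_cat (path_cat (path_rev (lg_src \o (fun=> lg_inv g))) c)
          (lg_tgt \o (lg_unit \o path_rev a)) =
          (fun r => path_rev a (2 * r + 0)).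
        apply/funext => r; rewrite /path_cat; case: ifPn => [hr|].
          by rewrite /= (gpd_tgt_unit gX) addr0.
        rewrite -ltNge => hr; rewrite /path_rev [RHS]a0; last lra.
        by case: ifP => _ //=; rewrite (gpd_src_inv gX).
      by apply: thin_homotopic_affine => //; lra.
have chu : lazy_chain (lg_unit (lg_src g)) [::] by [].
have ch2 : lazy_chain (lg_comp (lg_unit (a 0)) g) [:: (c, lg_inv g)].
  have [_ _ _] := chc; rewrite -h0 (gpd_comp_unitl gX) => -[? ? ? ?].
  by split.
pose G2 : lazy_path X := LazyPath (ch2 : lazy_chain (_, _).1 (_, _).2).
pose G3 : lazy_path X := LazyPath (chu : lazy_chain (_, _).1 (_, _).2).
have t2 : lazy_thin G1 G2.
  by apply: rst_step; left; apply: move_constant => r r'.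
have t3 : lazy_thin G2 G3.
  apply: rst_step; left => /=.
  rewrite -[X in lazy_move _ (X, _)](gpd_comp_invl gX) -h0 (gpd_comp_unitl gX).
  by apply: move_constant => r r'.
have -> : thin_class G = thin_class G3.
  by apply/thin_classP; apply: rst_trans t1 _; apply: rst_trans t2 t3.
exact: thin_unit_arrow.
Qed.

(** By induction on the order: once the first path is split off, the rest and
    its inverse meet in the middle of the composite and cancel, which leaves the
    first path followed by its reverse. *)
Lemma thin_comp_inv_class (R : realType) (X : lie_groupoid R)
    (G : lazy_path X) :
  thin_comp (thin_class (lp_inv G)) (thin_class G) = thin_unit (lp_src G).
Proof.
have gX := lg_groupoid X.
case: G => -[g l] /= hl; elim: l g hl => [|[a g1] l IHl] g hl.
  set G := LazyPath _.
  have h : lp_tgt G = lp_src (lp_inv G) by rewrite lp_src_inv.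
  rewrite (thin_comp_class h); apply: thin_unit_arrow => /=.
  by rewrite /raw_comp /= (gpd_comp_invl gX).
have [sa h0 h1 hl1] := hl.
set G := LazyPath _.
have chE : lazy_chain g [:: (a, lg_unit (a 1))].
  by split=> //; exact: (gpd_src_unit gX).
have chE' : lazy_chain (lg_unit (a 1)) [:: (path_rev a, lg_inv g)].
  split=> //; first exact: sitting_path_rev.
    by rewrite (gpd_tgt_unit gX) /path_rev subr0.
  by rewrite (gpd_src_inv gX) h0 /path_rev subrr.
pose E : lazy_path X := LazyPath (chE : lazy_chain (_, _).1 (_, _).2).
pose E' : lazy_path X := LazyPath (chE' : lazy_chain (_, _).1 (_, _).2).
pose G1 : lazy_path X := LazyPath (hl1 : lazy_chain (_, _).1 (_, _).2).
have tE : lp_tgt E = lp_src G1 by rewrite /lp_tgt /= (gpd_tgt_unit gX) -h1.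
have tE' : lp_tgt (lp_inv G1) = lp_src E'.
  by rewrite lp_tgt_inv /lp_src /= (gpd_src_unit gX).
have GE : G = lp_comp tE.
  apply: lazy_path_inj; rewrite /= /raw_comp /=.
  by rewrite -h1 (gpd_comp_unitr gX).
have GE' : lp_inv G = lp_comp tE'.
  apply: lazy_path_inj; rewrite /= raw_comp_unit//; last first.
    by rewrite lp_tgt_inv.
  by rewrite /raw_inv /= -raw_inv_rec_split.
have sG1 : lp_src G1 = a 1 by [].
have IH := IHl _ hl1; rewrite -/G1 in IH.
rewrite GE' [in X in thin_comp _ X]GE -!thin_comp_class.
have eG : thin_src (thin_class G1) = thin_tgt (thin_class E).
  by rewrite thin_src_class thin_tgt_class tE.
have eG' : thin_src (thin_class (lp_inv G1)) = thin_tgt (thin_class G1).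
  by rewrite thin_src_class thin_tgt_class lp_src_inv.
have eE' : thin_src (thin_class E') = thin_tgt (thin_class (lp_inv G1)).
  by rewrite thin_src_class thin_tgt_class tE'.
rewrite -thin_compA//; last by rewrite thin_tgt_comp.
rewrite [X in thin_comp _ X]thin_compA// IH.
have -> : lp_src G1 = thin_tgt (thin_class E) by rewrite thin_tgt_class tE.
rewrite thin_comp_unitl.
have hE : lp_tgt E = lp_src E'.
  by rewrite /lp_tgt /lp_src /= (gpd_src_unit gX) (gpd_tgt_unit gX).
rewrite (thin_comp_class hE); apply: lazy_thin_backtrack.
by rewrite /= raw_comp_unit// /lp_tgt /= (gpd_tgt_unit gX).
Qed.

(** The inverse passes to classes because inverses in a category are unique: the
    inverses of two representatives are both inverse to their common class. *)
Lemma thin_inv_class (R : realType) (X : lie_groupoid R) (G : lazy_path X) :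
  thin_inv (thin_class G) = thin_class (lp_inv G).
Proof.
rewrite /thin_inv; set H := repr _.
have HG : thin_class H = thin_class G by rewrite thin_class_repr.
have invK (K : lazy_path X) : lp_inv (lp_inv K) = K.
  by apply: lazy_path_inj; exact: raw_invK.
have [sHG tHG] : lp_src H = lp_src G /\ lp_tgt H = lp_tgt G.
  by apply: lazy_thin_ends; exact: lazy_thin_repr.
have eH : thin_src (thin_class (lp_inv H)) = thin_tgt (thin_class H).
  by rewrite thin_src_class thin_tgt_class lp_src_inv.
have eG : thin_src (thin_class G) = thin_tgt (thin_class (lp_inv G)).
  by rewrite thin_src_class thin_tgt_class lp_tgt_inv.
have := thin_comp_inv_class (lp_inv G); rewrite invK lp_src_inv => GV.
rewrite -[LHS]thin_comp_unitr thin_src_class lp_src_inv tHG -GV.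
rewrite thin_compA//; last by rewrite eH HG.
rewrite -[in X in thin_comp X _]HG thin_comp_inv_class sHG.
have -> : lp_src G = thin_tgt (thin_class (lp_inv G)).
  by rewrite thin_tgt_class lp_tgt_inv.
exact: thin_comp_unitl.
Qed.

Lemma thin_groupoid (R : realType) (X : lie_groupoid R) :
  is_groupoid (@thin_src R X) (@thin_tgt R X) (@thin_unit R X)
    (@thin_inv R X) (@thin_comp R X).
Proof.
split.
- exact: thin_src_unit.
- exact: thin_tgt_unit.
- by move=> a; rewrite /thin_inv thin_src_class lp_src_inv.
- by move=> a; rewrite /thin_inv thin_tgt_class lp_tgt_inv.
- exact: thin_src_comp.
- exact: thin_tgt_comp.
- exact: thin_compA.
- exact: thin_comp_unitr.
- exact: thin_comp_unitl.
- move=> a; rewrite -{2}[a]thin_class_repr; exact: thin_comp_inv_class.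
- move=> a; rewrite -{1}[a]thin_class_repr.
  have {1}-> : repr a = lp_inv (lp_inv (repr a)).
    by apply/esym/lazy_path_inj; exact: raw_invK.
  by rewrite thin_comp_inv_class lp_src_inv.
Qed.

(** * Diffeologies *)

Lemma open_local (T : topologicalType) (U : set T) :
  (forall u, U u -> exists V, [/\ V u, V `<=` U & open V]) -> open U.
Proof.
move=> h; rewrite openE => u /h[V [Vu VU oV]].
by apply: filterS VU _; exact: open_nbhs_nbhs.
Qed.

Lemma manifold_diffeology (R : realType) (M : manifold R) :
  is_diffeology (@manifold_plots R M).
Proof.
split.
- by move=> n U p [].
- by move=> n U p q pq [oU sp]; split=> //; exact: smooth_on_eq sp.
- by move=> n U x oU; split=> //; exact: smooth_on_cst.
- move=> n U p lp; split.
    by apply: open_local => u /lp[V [Vu VU []]]; exists V.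
  apply: smooth_on_local => u Uu; have [V [Vu VU [oV sp]]] := lp _ Uu.
  by exists V; split=> //; apply: smooth_on_subset sp => x [].
- move=> n m U V p F [oU sp] oV CF VU; split=> //.
  apply: smooth_on_comp (@finite_coordinates_row R n) oV CF _ sp.
  by move=> v Vv; split=> //; exact: VU.
Qed.

Lemma path_plots_smooth (R : realType) (M : manifold R) n m
    (U : set 'rV[R]_n) (V : set 'rV[R]_m) (p : 'rV[R]_n -> R -> M)
    (F : 'rV[R]_m -> 'rV[R]_n) :
  path_plots U p -> open V -> Cinfty V F -> (forall v, V v -> U (F v)) ->
  path_plots V (p \o F).
Proof.
move=> [oU sp] oV CF VU; split=> //.
pose O : set ('rV[R]_m * R) := fst @^-1` V.
have oO : open O by apply: open_comp => // x _; exact: cvg_fst.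
have CO : Cinfty O (fun z : 'rV[R]_m * R => (F z.1, z.2)).
  move=> k; apply: Ck_pair => //; last exact: Cinfty_snd.
  apply: Ck_comp (@finite_coordinates_row R m) oO _ (Cinfty_fst oO k) (CF k).
  by [].
have fV : finite_coordinates ('rV[R]_n * R)%type.
  exact: finite_coordinates_prod (@finite_coordinates_row R n)
    (finite_coordinates_real R).
apply: smooth_on_comp fV oO CO _ sp => -[v r] [/= Vv Ir].
by split=> //; split=> //=; exact: VU.
Qed.

Lemma path_plots_const (R : realType) (M : manifold R) n (U : set 'rV[R]_n)
    (p : 'rV[R]_n -> M) :
  manifold_plots U p -> path_plots U (fun u => path_const R (p u)).
Proof.
move=> [oU sp]; split=> //.
apply: smooth_on_comp (@finite_coordinates_row R n) openT (Cinfty_fst openT) _ sp.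
by move=> [u r] [].
Qed.

Lemma path_plots_rev (R : realType) (M : manifold R) n (U : set 'rV[R]_n)
    (p : 'rV[R]_n -> R -> M) :
  path_plots U p -> path_plots U (fun u => path_rev (p u)).
Proof.
move=> [oU sp]; split=> //.
have oT : open [set: 'rV[R]_n * R] by exact: openT.
have CT : Cinfty [set: 'rV[R]_n * R] (fun z => (z.1, (- 1) * z.2 + 1)).
  move=> k; apply: Ck_pair => //; first exact: Cinfty_fst.
  exact: Ck_comp (finite_coordinates_real R) oT (fun _ _ => I)
    (Cinfty_snd oT k) (@Cinfty_affine R (- 1) 1 k).
have fV : finite_coordinates ('rV[R]_n * R)%type.
  exact: finite_coordinates_prod (@finite_coordinates_row R n)
    (finite_coordinates_real R).
have := smooth_on_comp (B := U `*` I01 R) fV oT CT _ sp.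
have BA z : (U `*` I01 R) z ->
    [set: 'rV[R]_n * R] z /\ (U `*` I01 R) (z.1, (- 1) * z.2 + 1).
  case: z => u r [/= Uu /andP[r0 r1]]; split=> //; split=> //=.
  by rewrite /I01 /=; lra.
move=> /(_ BA); apply: smooth_on_eq => -[u r] _ /=.
by rewrite /path_rev mulN1r addrC.
Qed.

Lemma path_plots_eq (R : realType) (M : manifold R) n (U : set 'rV[R]_n)
    (p q : 'rV[R]_n -> R -> M) :
  (forall u, U u -> p u = q u) -> path_plots U p -> path_plots U q.
Proof.
move=> pq [oU sp]; split=> //; apply: smooth_on_eq sp => -[u r] [/= Uu _].
by rewrite pq.
Qed.

(** * Plots of lazy paths *)

Lemma lazy_order_plots_smooth (R : realType) (X : lie_groupoid R) k n m
    (U : set 'rV[R]_n) (V : set 'rV[R]_m) p (F : 'rV[R]_m -> 'rV[R]_n) :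
  @lazy_order_plots R X k n U p -> open V -> Cinfty V F ->
  (forall v, V v -> U (F v)) -> lazy_order_plots k V (p \o F).
Proof.
move=> [oU pk parr ppath] oV CF VU; split=> //.
- by move=> v /VU; exact: pk.
- move=> i hi; apply: plot_smooth (parr i hi) oV CF VU.
  exact: manifold_diffeology.
- by move=> i hi; apply: path_plots_smooth (ppath i hi) oV CF VU.
Qed.

Lemma lazy_order_plots_eq (R : realType) (X : lie_groupoid R) k n
    (U : set 'rV[R]_n) (p q : 'rV[R]_n -> lazy_path X) :
  (forall u, U u -> p u = q u) -> lazy_order_plots k U p ->
  lazy_order_plots k U q.
Proof.
move=> pq [oU pk parr ppath]; split=> //.
- by move=> u Uu; rewrite -pq//; exact: pk.
- move=> i hi; apply: plot_ext (parr i hi); first exact: manifold_diffeology.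
  by move=> u Uu; rewrite pq.
- by move=> i hi; apply: path_plots_eq (ppath i hi) => u Uu; rewrite pq.
Qed.

Lemma lazy_order_plots_const (R : realType) (X : lie_groupoid R) n
    (U : set 'rV[R]_n) (G : lazy_path X) :
  open U -> lazy_order_plots (lp_order G) U (fun=> G).
Proof.
move=> oU; split=> // i hi.
  by apply: plot_constant oU; exact: manifold_diffeology.
have [/sitting_path_smooth sa _ _] := lazy_chain_nth hi; split=> //.
apply: smooth_on_comp (finite_coordinates_real R) openT (Cinfty_snd openT) _ sa.
by [].
Qed.

Lemma lazy_diffeology (R : realType) (X : lie_groupoid R) :
  is_diffeology (@lazy_plots R X).
Proof.
split.
- by move=> n U p [].
- move=> n U p q pq [oU lp]; split=> // u /lp[V [k [Vu VU pV]]].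
  by exists V, k; split=> //; apply: lazy_order_plots_eq pV => v /VU; exact: pq.
- move=> n U G oU; split=> // u Uu; exists U, (lp_order G); split=> //.
  exact: lazy_order_plots_const.
- move=> n U p lp; split.
    by apply: open_local => u /lp[V [Vu VU [oV _]]]; exists V.
  move=> u /lp[V [Vu VU [_ /(_ _ Vu)[W [k [Wu WV pW]]]]]].
  by exists W, k; split=> //; exact: subset_trans VU.
- move=> n m U V p F [oU lp] oV CF VU; split=> // v Vv.
  have [W [k [Wv WU pW]]] := lp _ (VU _ Vv).
  have oW : open W by case: pW.
  have oVW := open_preimage_on oV oW (CF 0%N).
  exists (V `&` F @^-1` W), k; split=> //.
  have CFW : Cinfty (V `&` F @^-1` W) F.
    by move=> j; apply: Ck_subset (CF j) => x [].
  by apply: (lazy_order_plots_smooth pW oVW CFW) => x [].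
Qed.

Lemma quotient_diffeology (R : realType) (T Q : Type) (pi : T -> Q)
    (D : plots R T) :
  (forall y, exists x, pi x = y) -> is_diffeology D ->
  is_diffeology (quotient_plots pi D).
Proof.
move=> pi_surj hD; split.
- by move=> n U p [].
- move=> n U p q pq [oU lp]; split=> // u /lp[V [r [Vu VU Dr rp]]].
  by exists V, r; split=> // v Vv; rewrite rp// pq//; exact: VU.
- move=> n U y oU; split=> // u Uu; have [x xy] := pi_surj y.
  by exists U, (fun=> x); split=> //; exact: plot_constant.
- move=> n U p lp; split.
    by apply: open_local => u /lp[V [Vu VU [oV _]]]; exists V.
  move=> u /lp[V [Vu VU [_ /(_ _ Vu)[W [q [Wu WV Dq qp]]]]]].
  by exists W, q; split=> //; exact: subset_trans VU.
- move=> n m U V p F [oU lp] oV CF VU; split=> // v Vv.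
  have [W [q [Wv WU Dq qp]]] := lp _ (VU _ Vv).
  have oVW := open_preimage_on oV (plot_open hD Dq) (CF 0%N).
  exists (V `&` F @^-1` W), (q \o F); split=> //.
    have CFW : Cinfty (V `&` F @^-1` W) F.
      by move=> j; apply: Ck_subset (CF j) => x [].
    by apply: (plot_smooth hD Dq oVW CFW) => x [].
  by move=> x [_ Wx]; exact: qp.
Qed.

(** * Smoothness of the structure maps *)

Definition thin_plots (R : realType) (X : lie_groupoid R)
  : plots R (thin_arr X) := quotient_plots (@thin_class R X) (@lazy_plots R X).

Lemma thin_diffeology (R : realType) (X : lie_groupoid R) :
  is_diffeology (@thin_plots R X).
Proof.
have surj (a : thin_arr X) : exists G, thin_class G = a.
  by exists (repr a); exact: thin_class_repr.
exact: quotient_diffeology surj (@lazy_diffeology R X).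
Qed.

(** Two localisations are merged: that of the lift to lazy paths, and that to a
    neighbourhood on which the order is constant. *)
Lemma thin_plots_lift (R : realType) (X : lie_groupoid R) n
    (U : set 'rV[R]_n) (p : 'rV[R]_n -> thin_arr X) :
  @thin_plots R X n U p <-> open U /\ forall u, U u -> exists V k q,
    [/\ V u, V `<=` U, lazy_order_plots k V q &
        forall v, V v -> thin_class (q v) = p v].
Proof.
split=> [[oU lp]|[oU lp]]; split=> // u Uu.
  have [V [q [Vu VU [oV lq] qp]]] := lp _ Uu.
  have [W [k [Wu WV pW]]] := lq _ Vu.
  exists W, k, q; split=> //; first exact: subset_trans VU.
  by move=> v /WV; exact: qp.
have [V [k [q [Vu VU pV qp]]]] := lp _ Uu.
exists V, q; split=> //; split; first by case: pV.
by move=> v Vv; exists V, k; split=> // x.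
Qed.

Lemma thin_src_plots (R : realType) (X : lie_groupoid R) :
  diffeological_map (@thin_plots R X) (@manifold_plots R (lg_ob X))
    (@thin_src R X).
Proof.
move=> n U p /thin_plots_lift[oU lp].
apply: (plot_local (@manifold_diffeology R _)) => u /lp.
move=> [V [k [q [Vu VU [oV qk qa _] qp]]]]; exists V; split=> //.
have := qa 0%N (leq0n _) => -[_ s0]; split=> //.
apply: smooth_on_eq (smooth_on_map (@lg_src_submersion R X).1 s0) => v Vv /=.
by rewrite -qp// thin_src_class.
Qed.

Lemma thin_tgt_plots (R : realType) (X : lie_groupoid R) :
  diffeological_map (@thin_plots R X) (@manifold_plots R (lg_ob X))
    (@thin_tgt R X).
Proof.
move=> n U p /thin_plots_lift[oU lp].
apply: (plot_local (@manifold_diffeology R _)) => u /lp.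
move=> [V [k [q [Vu VU [oV qk qa _] qp]]]]; exists V; split=> //.
have := qa k (leqnn _) => -[_ sk]; split=> //.
apply: smooth_on_eq (smooth_on_map (@lg_tgt_submersion R X).1 sk) => v Vv /=.
by rewrite -qp// thin_tgt_class lp_tgtE qk.
Qed.

Lemma thin_unit_plots (R : realType) (X : lie_groupoid R) :
  diffeological_map (@manifold_plots R (lg_ob X)) (@thin_plots R X)
    (@thin_unit R X).
Proof.
move=> n U p pp; have [oU sp] := pp; apply/thin_plots_lift; split=> // u Uu.
exists U, 1%N, (fun u => lp_unit (p u)); split=> //; split=> //.
- move=> i hi; split=> //.
  apply: smooth_on_eq (smooth_on_map (@lg_unit_smooth R X) sp) => v _ /=.
  by case: i hi => [|[|]].
- by case=> // _; exact: path_plots_const.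
Qed.

Lemma thin_inv_plots (R : realType) (X : lie_groupoid R) :
  diffeological_map (@thin_plots R X) (@thin_plots R X) (@thin_inv R X).
Proof.
move=> n U p /thin_plots_lift[oU lp]; apply/thin_plots_lift; split=> // u.
move=> /lp[V [k [q [Vu VU [oV qk qa qp] qpE]]]].
exists V, k, (fun u => lp_inv (q u)); split=> //; last first.
  by move=> v Vv; rewrite /= -qpE// thin_inv_class.
split=> //.
- by move=> v Vv; rewrite lp_order_inv qk.
- move=> i hi; have [_ si] := qa (k - i)%N (leq_subr _ _); split=> //.
  apply: smooth_on_eq (smooth_on_map (@lg_inv_smooth R X) si) => v Vv /=.
  by rewrite lp_arr_inv qk.
- move=> i hi; have hi' : (k - i.+1 < k)%N by rewrite -subSn// subSS leq_subr.
  apply: path_plots_eq (path_plots_rev (qp _ hi')) => v Vv.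
  by rewrite lp_path_inv qk.
Qed.

Lemma lazy_order_plots_join (R : realType) (X : lie_groupoid R) k k' n
    (V : set 'rV[R]_n) (q q' r : 'rV[R]_n -> lazy_path X) :
  lazy_order_plots k V q -> lazy_order_plots k' V q' ->
  (forall v, V v -> lp_raw (r v) = raw_join (q' v) (q v)) ->
  lazy_order_plots (k + k'.+1) V r.
Proof.
move=> [oV qk qa qp] [_ qk' qa' qp'] rE.
have ordE v : V v -> lp_order (raw_join (q' v) (q v)) = (k + k'.+1)%N.
  by move=> Vv; rewrite lp_order_join qk ?qk'.
split=> //.
- by move=> v Vv; rewrite rE// ordE.
- move=> i hi.
  have arrE v : V v -> lp_arr i (r v) =
      if (i <= k)%N then lp_arr i (q v) else lp_arr (i - k.+1) (q' v).
    by move=> Vv; rewrite rE// lp_arr_join ?ordE// qk.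
  case: leqP arrE => hik arrE.
    by apply: plot_ext (qa i hik) => [|v /arrE ->]; [exact: manifold_diffeology|].
  have hi' : (i - k.+1 <= k')%N by rewrite leq_subLR addSn -addnS.
  by apply: plot_ext (qa' _ hi') => [|v /arrE ->]; [exact: manifold_diffeology|].
- move=> i hi.
  have pathE v : V v -> lp_path i (r v) =
      if (i < k)%N then lp_path i (q v)
      else if i == k then path_const R (lg_tgt (lp_arr k (q v)))
      else lp_path (i - k.+1) (q' v).
    by move=> Vv; rewrite rE// lp_path_join ?ordE// qk// lp_tgtE qk.
  case: ltnP pathE => hik pathE.
    by apply: path_plots_eq (qp i hik) => v /pathE ->.
  case: eqVneq pathE => ik pathE.
    have [_ sk] := qa k (leqnn _).
    have tk : manifold_plots V (fun v => lg_tgt (lp_arr k (q v))).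
      by split=> //; exact: smooth_on_map (@lg_tgt_submersion R X).1 sk.
    by apply: path_plots_eq (path_plots_const tk) => v /pathE ->.
  have lt : (k < i)%N by rewrite ltn_neqAle eq_sym ik.
  have hi' : (i - k.+1 < k')%N by rewrite ltn_subLR// addSn -addnS.
  by apply: path_plots_eq (qp' _ hi') => v /pathE ->.
Qed.

(** The lifts of the two factors are joined. They match at every point because
    source and target are read off the classes, which are composable. *)
Lemma thin_comp_plots (R : realType) (X : lie_groupoid R) :
  diffeological_map
    (fibre_plots (@thin_src R X) (@thin_tgt R X) (@thin_plots R X)
      (@thin_plots R X)) (@thin_plots R X)
    (fun z : fibre_product (@thin_src R X) (@thin_tgt R X) =>
      thin_comp (sval z).1 (sval z).2).
Proof.
move=> n U p [/thin_plots_lift[oU lp'] /thin_plots_lift[_ lp]].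
apply/thin_plots_lift; split=> // u Uu.
have [V' [k' [q' [Vu' VU' pV' qp']]]] := lp' _ Uu.
have [V [k [q [Vu VU pV qp]]]] := lp _ Uu.
have oV : open V by case: pV.
have oV' : open V' by case: pV'.
have oI : open (V `&` V') by exact: openI.
have h v : (V `&` V') v -> lp_tgt (q v) = lp_src (q' v).
  move=> [Vv Vv']; rewrite -thin_tgt_class -thin_src_class qp// qp'//.
  by rewrite (svalP (p v)).
pose r v := if pselect (lp_tgt (q v) = lp_src (q' v)) is left e
  then lp_join e else q v.
have rE v : (V `&` V') v -> exists e : lp_tgt (q v) = lp_src (q' v),
    r v = lp_join e.
  by move=> Vv; rewrite /r; case: pselect => [e|/(_ (h v Vv))//]; exists e.
have Cid : Cinfty (V `&` V') (id : 'rV[R]_n -> 'rV[R]_n).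
  by move=> j; exact: Ck_id.
have pI : lazy_order_plots k (V `&` V') q.
  by apply: (lazy_order_plots_smooth (F := id) pV oI Cid) => v [].
have pI' : lazy_order_plots k' (V `&` V') q'.
  by apply: (lazy_order_plots_smooth (F := id) pV' oI Cid) => v [].
exists (V `&` V'), (k + k'.+1)%N, r; split=> //.
- by move=> v [/VU].
- by apply: lazy_order_plots_join pI pI' _ => v /rE[e ->].
- move=> v Vv; have [e ->] := rE v Vv; have [Vv1 Vv2] := Vv.
  by rewrite -thin_comp_join qp// qp'.
Qed.

Theorem theorem4p6 (R : realType) (X : lie_groupoid R) :
  exists (src tgt : thin_arr X -> lg_ob X) (unit : lg_ob X -> thin_arr X)
         (inv : thin_arr X -> thin_arr X)
         (comp : thin_arr X -> thin_arr X -> thin_arr X),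
    [/\ forall G : lazy_path X, src (thin_class G) = lp_src G,
        forall G : lazy_path X, tgt (thin_class G) = lp_tgt G,
        forall x : lg_ob X, unit x = thin_class (lp_unit x),
        forall G : lazy_path X, inv (thin_class G) = thin_class (lp_inv G) &
        forall (G' G : lazy_path X) (h : lp_tgt G = lp_src G'),
          comp (thin_class G') (thin_class G) = thin_class (lp_comp h)] /\
    is_diffeological_groupoid
      (@manifold_plots R (lg_ob X))
      (quotient_plots (@thin_class R X) (@lazy_plots R X))
      src tgt unit inv comp.
Proof.
exists (@thin_src R X), (@thin_tgt R X), (@thin_unit R X), (@thin_inv R X),
  (@thin_comp R X); split; split.
- exact: thin_src_class.
- exact: thin_tgt_class.
- by [].
- exact: thin_inv_class.
- exact: thin_comp_class.
- exact: thin_groupoid.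
- exact: manifold_diffeology.
- exact: thin_diffeology.
- exact: thin_src_plots.
- exact: thin_tgt_plots.
- exact: thin_unit_plots.
- exact: thin_inv_plots.
- exact: thin_comp_plots.
Qed.
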